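(* Let $d\ge 1$ and let $\mu$ be any integer partition. Then each of the functions $(\mathbf p,\mathbf r)\mapsto S^\star_\mu(\mathbf r^{\mathbf p})$ and $(\mathbf p,\mathbf r)\mapsto \mathrm{Ko}_\mu(\mathbf r^{\mathbf p})$, defined for $\mathbf p=(p_1,\dots,p_d)$ and $\mathbf r=(r_1,\dots,r_d)$ in $\mathbb Z_{\ge0}^d$, is given by a polynomial in $\mathbb Q[p_1,\dots,p_d,r_1,\dots,r_d]$ whose expansion in the falling factorial basis has only non-negative rational coefficients.
   Context: Partitions and Young diagrams are identified. For a Young diagram $\lambda$ with $\ell$ rows and a family $F=(F_N)_{N\ge1}$ of polynomials with $F_{N+1}(x_1,\dots,x_N,0)=F_N(x_1,\dots,x_N)$, write $F(\lambda)=F_\ell(\lambda_1,\dots,\lambda_\ell)$. Multirectangular coordinates: for $\mathbf p=(p_1,\dots,p_d)$ and $\mathbf r=(r_1,\dots,r_d)$ with non-negative integer entries, $\mathbf r^{\mathbf p}$ denotes the Young diagram which, for $s=1,\dots,d$ in this order from top to bottom, has $p_s$ rows of length $r_s+r_{s+1}+\dots+r_d$. Falling factorials: $(x)_a=x(x-1)\cdots(x-a+1)$, with $(x)_0=1$. The falling factorial basis of $\mathbb Q[p_1,\dots,p_d,r_1,\dots,r_d]$ consists of the products $(p_1)_{a_1}\cdots(p_d)_{a_d}(r_1)_{b_1}\cdots(r_d)_{b_d}$ with $a_i,b_i\ge 0$. Shifted Schur function: for a partition $\mu$ and $n\ge \ell(\mu)$ (with $\mu_j=0$ for $j>\ell(\mu)$),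 $S^\star_\mu(x_1,\dots,x_n)=\det\big((x_i+n-i)_{\mu_j+n-j}\big)_{i,j\le n}/\det\big((x_i+n-i)_{n-j}\big)_{i,j\le n}$. Kostka numbers: $K^\lambda_\tau$ is the number of semi-standard Young tableaux of shape $\lambda$ and type $\tau$, i.e. with exactly $\tau_i$ entries equal to $i$. For $\mu\vdash k$, $\mu1^{n-k}$ denotes the partition of $n$ obtained from $\mu$ by appending $n-k$ parts equal to $1$. For a Young diagram $\lambda$ with $|\lambda|=n$, $\mathrm{Ko}_\mu(\lambda)=(n)_k\,K^\lambda_{\mu1^{n-k}}/K^\lambda_{1^n}$ if $n\ge k$, and $\mathrm{Ko}_\mu(\lambda)=0$ if $n<k$. *)

(* Defs.v *)
From HB Require Import structures.
From mathcomp Require Import all_boot all_order all_algebra.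
Set Implicit Arguments. Unset Strict Implicit. Unset Printing Implicit Defensive.
Import Order.TTheory GRing.Theory Num.Theory.

Definition is_partition (mu : seq nat) : bool :=
  sorted geq mu && all (fun x => 0 < x) mu.

(* Multirectangular diagram r^p : for s = 1..d (top to bottom), p_s rows of
   length r_s + ... + r_d.  (Rows of length 0 may appear; all functions below
   are stable under appending zero rows.) *)
Definition multirect (d : nat) (p r : 'I_d -> nat) : seq nat :=
  flatten [seq nseq (p s) (\sum_(t < d | s <= t) r t)%N | s <- enum 'I_d].

(* Shifted Schur function S*_mu evaluated on lambda, with n = size lambda +
   size mu variables (lambda padded by zeros; n >= l(mu)). *)
Definition shifted_schur (mu lam : seq nat) : rat :=
  let n := (size lam + size mu)%N in
  let x := fun i : 'I_n => (nth 0 lam i + (n - 1 - i))%N in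
  (\det (\matrix_(i < n, j < n) ((x i) ^_ (nth 0 mu j + (n - 1 - j)))%:R : 'M[rat]_n)
   / \det (\matrix_(i < n, j < n) ((x i) ^_ (n - 1 - j))%:R : 'M[rat]_n))%R.

Definition cells (lam : seq nat) : seq (nat * nat) :=
  [seq (i, j) | i <- iota 0 (size lam), j <- iota 0 (nth 0 lam i)].

(* A filling f of the cells of lam, value v : 'I_(size tau) standing for the
   entry v+1, is a semi-standard Young tableau of type tau. *)
Definition is_ssyt (lam tau : seq nat)
    (f : {ffun 'I_(size (cells lam)) -> 'I_(size tau)}) : bool :=
  [forall a : 'I_(size (cells lam)), forall b : 'I_(size (cells lam)),
     let ca := nth (0, 0) (cells lam) a in
     let cb := nth (0, 0) (cells lam) b in
     ((cb == (ca.1, ca.2.+1)) ==> (f a <= f b)) &&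
     ((cb == (ca.1.+1, ca.2)) ==> (f a < f b))] &&
  [forall v : 'I_(size tau), #|[pred a | f a == v]| == nth 0 tau v].

Definition kostka (lam tau : seq nat) : nat :=
  #|[pred f : {ffun 'I_(size (cells lam)) -> 'I_(size tau)} | @is_ssyt lam tau f]|.

Definition Ko (mu lam : seq nat) : rat :=
  let n := sumn lam in let k := sumn mu in
  if k <= n then
    ((n ^_ k)%:R * (kostka lam (mu ++ nseq (n - k) 1))%:R
      / (kostka lam (nseq n 1))%:R)%R
  else 0%R.

Definition ff_monomial (d : nat) (a b p r : 'I_d -> nat) : rat :=
  (\prod_(i < d) ((p i) ^_ (a i))%:R * \prod_(i < d) ((r i) ^_ (b i))%:R)%R.

(* f is given by a polynomial in Q[p_1..p_d, r_1..r_d] whose expansion in the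
   falling factorial basis has non-negative coefficients: a finite non-negative
   combination of falling factorial basis elements (listed as
   (exponents a, exponents b, coefficient)) agreeing with f on Z_{>=0}^{2d}. *)
Definition nonneg_ff_polynomial (d : nat) (f : ('I_d -> nat) -> ('I_d -> nat) -> rat) : Prop :=
  exists s : seq (('I_d -> nat) * ('I_d -> nat) * rat),
    all (fun t => (0 <= t.2)%R) s /\
    forall p r, f p r = (\sum_(t <- s) t.2 * ff_monomial t.1.1 t.1.2 p r)%R.

(* Main.v *)
(* Put [n = |lam|], [k = |mu|], [l_i = lam_i + N - i], [m_i = mu_i + N - i], and let
   [D m l] be the determinant of the [1 / (l_i - m_j)!].  Then S*_mu (lam) is
   [D m l / D delta l], and [(n - k)! D m l] is both the multiplicity of chi^mu in the
   restriction of chi^lam to S_k (Frobenius' formula for chi) and the number of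
   standard tableaux of shape lam/mu.  Since [n! chi^lam / chi^lam (1)] is the sum
   of the Young symmetrizers [a_T b_T] over the bijective fillings T of lam,
     S*_mu (lam) = 1/k! * sum over T : [k] -> cells of lam of chi^mu (a_T b_T).
   Each term is a sum of squares, hence nonnegative, and depends only on which
   entries of T share a row or a column.  On a multirectangular diagram, the number
   of T with a given pattern of coincidences, and with given blocks for the rows
   and columns, is a product of falling factorials.
   Removing the entries 1 one at a time from a tableau of type mu 1^(n-k) shows
   that Ko_mu is the sum of the [K^nu_mu S*_nu] over the partitions nu of k. *)
Require Import Defs.
From HB Require Import structures.
From mathcomp Require Import all_boot all_order all_algebra.
From mathcomp Require Import all_fingroup all_field all_character.
From mathcomp Require Import mpoly ring zify.
Set Implicit Arguments. Unset Strict Implicit. Unset Printing Implicit Defensive.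
Import Order.TTheory GRing.Theory Num.Theory.

(** * Contents and relabelings of words *)

(** No Specht module is built: the characters of the symmetric group enter only as the
    integer-valued function [chi], a signed count of words fixed by a permutation. Irreducibility
    has to be deduced. Being a signed sum of permutation characters of norm one, [chi] is an
    irreducible character up to sign; the Young symmetrizer of a bijective filling settles the sign,
    since irreducible characters are nonnegative on it and [chi] is positive on it. All other
    irreducible characters vanish on that symmetrizer, which yields the expansion over fillings. The
    determinants need at least as many variables as the diagram has rows, whereas the coefficients
    of the polynomial must not depend on the diagram; the stability of [chi] under extra variables
    reconciles the two. The sum runs over all maps T, injective or not: the symmetrizer of a filling
    that repeats a cell vanishes, and without injectivity the row map and the column map are tied
    together only through their blocks, so that their counts multiply. *)

Section Content.
Variables (n : nat) (J : finType).
Implicit Types (f F : {ffun 'I_n -> J}) (g h : 'S_n).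

Definition content f (j : J) : nat := #|[pred x | f x == j]|.

Definition relabel f g : {ffun 'I_n -> J} := [ffun x => f (g x)].

Definition fixed_by f g : bool := relabel f g == f.

Lemma fixed_byP f g : reflect (forall x, f (g x) = f x) (fixed_by f g).
Proof.
apply: (iffP eqP) => [fg x|fg]; first by rewrite -{2}fg ffunE.
by apply/ffunP => x; rewrite ffunE.
Qed.

Lemma content_sum f : (\sum_j content f j = n)%N.
Proof.
rewrite -[RHS]card_ord -sum1_card (partition_big f xpredT) //=.
by apply: eq_bigr => j _; rewrite sum1_card.
Qed.

Lemma content_relabel f g : content (relabel f g) =1 content f.
Proof.
move=> j; rewrite /content -(card_image (@perm_inj _ g) [pred x | relabel f g x == j]).
apply: eq_card => y; rewrite !inE; apply/imageP/eqP.
  by move=> [x]; rewrite inE ffunE => /eqP <- ->.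
move=> fy; exists (g^-1 y)%g; last by rewrite permKV.
by rewrite inE ffunE permKV fy.
Qed.

Lemma relabelM f g h : relabel f (g * h)%g = relabel (relabel f h) g.
Proof. by apply/ffunP => x; rewrite !ffunE permM. Qed.

Lemma relabel1 f : relabel f 1%g = f.
Proof. by apply/ffunP => x; rewrite ffunE perm1. Qed.

Lemma relabelK f g : relabel (relabel f g) (g^-1)%g = f.
Proof. by rewrite -relabelM mulVg relabel1. Qed.

Lemma content_conj f F : content f =1 content F -> exists g, F = relabel f g.
Proof.
move=> eqc; have cE (k : {ffun 'I_n -> J}) j : count_mem j [tuple k x | x < n] = content k j.
  by rewrite /content cardE -sum1_size big_filter /= count_map -sum1_count enumT.
have /tuple_permP [p Hp] : perm_eq [tuple F x | x < n] [tuple f x | x < n].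
  by apply/allP => j _; apply/eqP; rewrite !cE.
exists p; apply/ffunP => x; rewrite ffunE.
have /(congr1 (fun t => tnth t x)): [tuple F x | x < n] = [tuple tnth [tuple f x | x < n] (p i) | i < n].
  exact/val_inj.
by rewrite !tnth_mktuple.
Qed.

Lemma content_exists (a : J -> nat) : (\sum_j a j = n)%N ->
  exists f, content f =1 a.
Proof.
move=> suma.
pose X : finType := {j : J & 'I_(a j)}.
have cX : #|X| = n.
  rewrite card_tagged sumnE big_map big_enum /= -suma.
  by apply: eq_bigr => j _; rewrite card_ord.
pose e (x : 'I_n) : X := enum_val (cast_ord (esym cX) x).
have ei : injective e by move=> x y /enum_val_inj /cast_ord_inj.
exists [ffun x => tag (e x)] => j.
rewrite -[RHS]card_ord /content -(card_image ei).
have inj : injective (fun i : 'I_(a j) => Tagged (fun j => 'I_(a j)) i : X).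
  by move=> i i' /eqP; rewrite eq_Tagged /= => /eqP.
rewrite -(card_image inj); apply: eq_card => -[j' i]; apply/imageP/imageP => /=.
  move=> [x]; rewrite !inE ffunE => /eqP <- ee; rewrite -ee /=.
  by exists i.
move=> [i' _ ee]; exists (cast_ord cX (enum_rank (Tagged (fun j => 'I_(a j)) i' : X))).
  by rewrite !inE ffunE /e cast_ordK enum_rankK.
by rewrite ee /e cast_ordK enum_rankK.
Qed.

(** Words with the content of [f] form one orbit under relabeling, and the fibre of [relabel f] over
    [F] is a coset of the stabilizer of [F]. *)
Lemma sum_relabel (R : pzRingType) f (w : {ffun 'I_n -> J} -> R) :
  (\sum_g w (relabel f g) =
   \sum_(F | [forall j, content F j == content f j]) w F *+ #|[pred g | fixed_by F g]|)%R.
Proof.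
rewrite (partition_big (relabel f) (fun F => [forall j, content F j == content f j])) /=; last first.
  by move=> g _; apply/forallP => j; rewrite content_relabel.
apply: eq_bigr => F /forallP eqc.
have [h Fh] := @content_conj f F (fun j => esym (eqP (eqc j))).
rewrite -sumr_const; under eq_bigr => g /eqP -> do [].
rewrite (reindex_inj (mulIg h)) /=.
apply: eq_bigl => g; rewrite !inE relabelM /fixed_by Fh.
done.
Qed.

Lemma fixed_by_relabel f h g : fixed_by (relabel f h) g = fixed_by f (g ^ h)%g.
Proof.
rewrite /fixed_by conjgE -relabelM (relabelM f h^-1).
apply/eqP/eqP => [->|e]; first exact: relabelK.
by rewrite -[in RHS]e -relabelM mulgV relabel1.
Qed.

Lemma card_fixed_content f F : content F =1 content f ->
  #|[pred g | fixed_by F g]| = #|[pred g | fixed_by f g]|.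
Proof.
move=> eqc; have [h ->] := @content_conj f F (fun j => esym (eqc j)).
rewrite -(card_image (conjg_inj h) [pred g | fixed_by (relabel f h) g]) /=.
apply: eq_card => g; rewrite !inE; apply/imageP/idP => [[x]|fg].
  by rewrite inE fixed_by_relabel => fx ->.
by exists (g ^ h^-1)%g; rewrite ?inE ?fixed_by_relabel conjgKV.
Qed.
End Content.

(** * Frobenius' formula and orthogonality *)

Section FixedCount.
Local Open Scope ring_scope.

(** Orbit counting: the words of content [A] form one orbit, so there are n! pairs of such a word
    and a permutation fixing it. The bound [b] makes the contents range over a finite type. *)
Lemma sum_fixed_content (R : pzRingType) n b (J : finType)
    (phi : {ffun J -> 'I_b.+1} -> R) : (n <= b)%N ->
  \sum_(F : {ffun 'I_n -> J}) \sum_(g | fixed_by F g) phi [ffun j => inord (content F j)]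
  = (\sum_(A : {ffun J -> 'I_b.+1} | (\sum_j A j == n)%N) phi A) *+ n`!.
Proof.
move=> nb; under eq_bigr => F _ do rewrite sumr_const.
have cb (F : {ffun 'I_n -> J}) j : (content F j < b.+1)%N.
  by rewrite ltnS (leq_trans _ nb) // -[leqRHS]card_ord max_card.
rewrite (partition_big (fun F : {ffun 'I_n -> J} => [ffun j => inord (content F j) : 'I_b.+1])
  (fun A => \sum_j A j == n)%N) /=; last first.
  move=> F _; rewrite -[eqbRHS](content_sum F); apply/eqP.
  by apply: eq_bigr => j _; rewrite ffunE inordK.
rewrite -sumrMnl; apply: eq_bigr => A /eqP /content_exists [f fA].
have := sum_relabel f (fun _ => phi A); rewrite sumr_const.
rewrite card_Sn.
move=> ->; apply: eq_big => [F|F /eqP -> //].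
apply/idP/forallP => [/eqP eA j|cF]; first by rewrite fA -eA ffunE inordK.
by apply/eqP/ffunP => j; rewrite ffunE (eqP (cF j)) fA inord_val.
Qed.

End FixedCount.

Section Orthonormality.
Local Open Scope ring_scope.

Definition stair N (j : 'I_N) : nat := N - j.+1.

(** Column [j] stands for the Vandermonde exponent that completes [c i] to [u i]; the determinant is
    the coefficient of y^u in the Vandermonde determinant times the monomial y^c. *)
Definition slot N (u : 'I_N -> nat) (c : 'I_N -> nat) : 'M[int]_N :=
  \matrix_(i, j) (c i + stair j == u i)%N%:R.

Lemma eq_slot N (u c c' : 'I_N -> nat) : c =1 c' -> slot u c = slot u c'.
Proof. by move=> e; apply/matrixP => i j; rewrite !mxE e. Qed.

(* Frobenius' character formula: the coefficient of [y^u] in the product of the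
   Vandermonde determinant by the power sum of cycle type [g]. *)
Definition chi n N (u : 'I_N -> nat) (g : 'S_n) : int :=
  \sum_(f : {ffun 'I_n -> 'I_N} | fixed_by f g)
    \det (slot u (content f)).

Variables (N : nat) (P : comNzRingType) (y : 'I_N -> P) (B : nat).

(** Geometric series truncated at degree [B]: they remain polynomials, and the coefficients of [H]
    up to degree [B] are the complete homogeneous sums h_r. *)
Let geom (l : 'I_N) : {poly P} := \poly_(r < B.+1) y l ^+ r.
Let H : {poly P} := \prod_l geom l.

Lemma coef_prod_geom r : 
  H`_r = \sum_(a : {ffun 'I_N -> 'I_B.+1} | (\sum_j a j == r)%N) \prod_j y j ^+ a j.
Proof.
rewrite /H /geom; under eq_bigr => l _ do rewrite poly_def.
rewrite bigA_distr_bigA coef_sum [RHS]big_mkcond /=; apply: eq_bigr => a _.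
transitivity (((\prod_j y j ^+ a j) *: 'X^(\sum_j a j)%N : {poly P})`_r).
  by rewrite -prodrXr -scaler_prod.
by rewrite coefZ coefXn eq_sym; case: eqP; rewrite ?mulr1 ?mulr0.
Qed.

(** Multiplication by [c] telescopes every geometric factor except that of [k]; the truncation
    errors all have degree above [B]. *)
Lemma coef_mul_geom (c : {poly P}) (k : 'I_N) r : (r <= B)%N ->
  c = \prod_(l | l != k) (1 - y l *: 'X) -> (c * H)`_r = y k ^+ r.
Proof.
move=> rB ->.
have geomE l : (1 - y l *: 'X) * geom l = 1 - y l ^+ B.+1 *: 'X^(B.+1).
  rewrite /geom poly_def -[1 in RHS](expr1n _ B.+1) -exprZn.
  rewrite subrXX; congr (_ * _); apply: eq_bigr => i _.
  by rewrite expr1n mul1r exprZn.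
rewrite /H [in X in _ * X](bigD1 k) //= mulrCA -big_split /=.
under eq_bigr => l _ do rewrite geomE.
have [q ->] : exists q : {poly P}, \prod_(l | l != k) (1 - y l ^+ B.+1 *: 'X^(B.+1)) = 1 + q * 'X^(B.+1).
  elim/big_ind: _ => [|_ _ [q1 ->] [q2 ->]|l _]; first by exists 0; rewrite mul0r addr0.
    exists (q1 + q2 + q1 * q2 * 'X^(B.+1)); ring.
  by exists (- (y l ^+ B.+1)%:P); rewrite mulNr mul_polyC.
rewrite mulrDr mulr1 coefD mulrA coefMXn ltnS rB addr0 coef_poly ltnS rB //.
Qed.

Definition hmat (u : 'I_N -> nat) : 'M[P]_N :=
  \matrix_(i, j) (if (stair j <= u i)%N then H`_(u i - stair j) else 0).

Lemma stair_le (i : 'I_N) : (stair i < N)%N.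
Proof. by rewrite /stair; case: i => i /= ?; lia. Qed.

(** The Jacobi-Trudi identity. The matrix [E] does not depend on [u], and [hmat u *m E] is the
    matrix of powers; for the staircase [hmat] is unitriangular, so the determinant of [E] is the
    Vandermonde determinant. *)
Lemma det_hmat (u : 'I_N -> nat) : (forall i, u i <= B)%N -> (N <= B)%N ->
  \det (\matrix_(i, k) y k ^+ stair i) * \det (hmat u) = \det (\matrix_(i, k) y k ^+ u i).
Proof.
move=> uB NB.
pose c k : {poly P} := \prod_(l | l != k) (1 - y l *: 'X).
pose E : 'M[P]_N := \matrix_(j, k) (c k)`_(stair j).
have sc k : (size (c k) <= N)%N.
  have sl l : (size (1 - y l *: 'X)%R <= 2)%N.
    rewrite (leq_trans (size_polyD _ _)) // size_polyN size_poly1 geq_max /=.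
    by rewrite (leq_trans (size_scale_leq _ _)) ?size_polyX.
  rewrite (leq_trans (size_poly_prod_leq _ _)) //.
  have : (\sum_(l | l != k) size (1 - y l *: 'X)%R <= \sum_(l | l != k) 2)%N.
    by apply: leq_sum => l _.
  rewrite sum_nat_const; have := cardC1 k; rewrite card_ord => ->.
  have ar (m s : nat) : (m < N -> s <= N.-1 * 2 -> s.+1 - N.-1 <= N)%N by lia.
  exact: ar (ltn_ord k).
have key (v : 'I_N -> nat) : (forall i, v i <= B)%N ->
    hmat v *m E = \matrix_(i, k) y k ^+ v i.
  move=> vB; apply/matrixP => i k; rewrite !mxE -(coef_mul_geom (vB i) (erefl (c k))).
  rewrite coefM; pose r := v i; rewrite -/r.
  pose G a := if (a <= r)%N then (c k)`_a * H`_(r - a) else 0.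
  have GN m : (forall a, (m <= a)%N -> G a = 0) -> (m <= N + r.+1)%N ->
      \sum_(a < m) G a = \sum_(a < N + r.+1) G a.
    move=> G0 mle; rewrite (big_ord_widen _ _ mle) big_mkcond /=; apply: eq_bigr => a _.
    by case: ltnP => // /G0 ->.
  transitivity (\sum_(a < N) G a).
    rewrite (reindex_inj rev_ord_inj) /=; apply: eq_bigr => j _.
    rewrite !mxE /G; have -> : stair (rev_ord j) = j.
      by rewrite /stair /=; have := ltn_ord j; lia.
    by case: ifP => _; rewrite ?mul0r // mulrC.
  transitivity (\sum_(a < r.+1) G a).
    rewrite !GN ?leq_addl ?leq_addr // => a ha.
      by rewrite /G leqNgt ha.
    by rewrite /G nth_default ?(leq_trans (sc k)) // mul0r if_same.
  by apply: eq_bigr => a _; rewrite /G -ltnS ltn_ord.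
rewrite -(key u uB) det_mulmx mulrC; congr (_ * _).
rewrite -(key (@stair N)) => [|i]; last by rewrite (leq_trans (ltnW (stair_le i))).
rewrite det_mulmx -[RHS]mul1r; congr (_ * _).
rewrite -det_tr det_trig; last first.
  apply/is_trig_mxP => i j ij; rewrite !mxE leqNgt ifN // negbK /stair.
  by have := ltn_ord j; move: ij => /=; lia.
rewrite big1 // => i _; rewrite !mxE leqnn subnn coef_prod_geom.
rewrite (big_pred1 [ffun=> ord0]) /=; first by rewrite big1 // => j _; rewrite ffunE expr0.
move=> a /=; rewrite sum_nat_eq0; apply/forallP/eqP => [a0|-> j]; last by rewrite ffunE.
by apply/ffunP => j; rewrite ffunE; apply/val_inj/eqP/a0.
Qed.
End Orthonormality.

Section PowerSum.
Local Open Scope ring_scope.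
Variables (n N : nat).

Lemma content_fst (J K : finType) (F : {ffun 'I_n -> J * K}) i :
  content [ffun x => (F x).1] i = (\sum_j content F (i, j))%N.
Proof.
rewrite /content -sum1_card (partition_big (fun x => (F x).2) xpredT) //=.
apply: eq_bigr => j _; rewrite sum1_card; apply: eq_card => x; rewrite [LHS]unfold_in !inE ffunE.
by rewrite -pair_eqE; case: (F x).
Qed.

Lemma content_snd (J K : finType) (F : {ffun 'I_n -> J * K}) j :
  content [ffun x => (F x).2] j = (\sum_i content F (i, j))%N.
Proof.
rewrite /content -sum1_card (partition_big (fun x => (F x).1) xpredT) //=.
apply: eq_bigr => i _; rewrite sum1_card; apply: eq_card => x; rewrite [LHS]unfold_in !inE ffunE.
by rewrite -pair_eqE andbC; case: (F x).
Qed.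

Lemma fixed_by_pair (J K : finType) (F : {ffun 'I_n -> J * K}) g :
  fixed_by F g = fixed_by [ffun x => (F x).1] g && fixed_by [ffun x => (F x).2] g.
Proof.
apply/fixed_byP/andP => [fF|[/fixed_byP f1 /fixed_byP f2] x].
  by split; apply/fixed_byP => x; rewrite !ffunE fF.
by move: (f1 x) (f2 x); rewrite !ffunE; case: (F (g x)) (F x) => [? ?] [? ?] /= -> ->.
Qed.

Variables (P : comNzRingType) (y : 'I_N -> P).

Definition power_sum (g : 'S_n) : P :=
  \sum_(f : {ffun 'I_n -> 'I_N} | fixed_by f g) \prod_j y j ^+ content f j.

(** Expanding each h_r into monomials indexes a term of the determinant by a matrix [A] of exponents
    with prescribed row sums; the monomial only sees its column sums. *)
Lemma hmat_family B (u : 'I_N -> nat) : (forall i, (u i <= B)%N) ->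
  \det (hmat y B u) = \sum_(w : 'S_N) (-1) ^+ w *
    \sum_(A : {ffun 'I_N * 'I_N -> 'I_B.+1} |
       [forall i, (\sum_j A (i, j) + stair (w i) == u i)%N])
      \prod_j y j ^+ (\sum_i A (i, j))%N.
Proof.
move=> uB; apply: eq_bigr => w _; congr (_ * _).
pose Q i (a : {ffun 'I_N -> 'I_B.+1}) := (\sum_j a j + stair (w i) == u i)%N.
transitivity (\prod_i \sum_(a | Q i a) \prod_j y j ^+ a j).
  apply: eq_bigr => i _; rewrite mxE; case: leqP => su.
    rewrite coef_prod_geom; apply: eq_bigl => a; rewrite /Q.
    by apply/eqP/eqP; lia.
  by rewrite big_pred0 // => a; rewrite /Q; apply/eqP; lia.
rewrite bigA_distr_big_dep /=.
rewrite (reindex (fun A : {ffun 'I_N * 'I_N -> 'I_B.+1} =>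
  [ffun i => [ffun j => A (i, j)]])) /=; last first.
  exists (fun F : {ffun 'I_N -> {ffun 'I_N -> 'I_B.+1}} => [ffun p => F p.1 p.2]).
    by move=> A _; apply/ffunP => -[i j]; rewrite !ffunE.
  by move=> F _; apply/ffunP => i; apply/ffunP => j; rewrite !ffunE.
apply: eq_big => [A|A _].
  have QE i : Q i [ffun j => A (i, j)] = (\sum_j A (i, j) + stair (w i) == u i)%N.
    by rewrite /Q; under eq_bigr => j _ do rewrite ffunE.
  by apply/familyP/forallP => h i; move: (h i); rewrite -QE ffunE.
rewrite exchange_big /=; apply: eq_bigr => j _; rewrite -prodrXr.
by apply: eq_bigr => i _; rewrite !ffunE.
Qed.

(** Both factors are sums over words fixed by [g], so their product is a sum over words in pairs of
    letters fixed by [g]. Orbit counting turns it into n! times a sum over contents, which are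
    matrices whose row and column sums are the contents of the two words, as in [hmat_family]. *)
Lemma sum_chi_power_sum B (u : 'I_N -> nat) : (forall i, (u i <= B)%N) -> (n <= B)%N ->
    (\sum_i u i = n + \sum_(i < N) stair i)%N ->
  \sum_(g : 'S_n) (chi u g)%:~R * power_sum g = \det (hmat y B u) *+ n`!.
Proof.
move=> uB nB su.
pose phi (A : {ffun 'I_N * 'I_N -> 'I_B.+1}) : P :=
  (\det (slot u (fun i => \sum_j A (i, j))%N))%:~R * \prod_j y j ^+ (\sum_i A (i, j))%N.
transitivity (\sum_(F : {ffun 'I_n -> 'I_N * 'I_N}) \sum_(g | fixed_by F g)
    phi [ffun p => inord (content F p)]).
  rewrite [RHS](exchange_big_dep xpredT) //=; apply: eq_bigr => g _.
  rewrite /chi /power_sum rmorph_sum /= big_distrlr /= pair_big /=.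
  rewrite (reindex (fun F : {ffun 'I_n -> 'I_N * 'I_N} =>
    ([ffun x => (F x).1] : {ffun 'I_n -> 'I_N}, [ffun x => (F x).2] : {ffun 'I_n -> 'I_N}))) /=; last first.
    exists (fun p : {ffun 'I_n -> 'I_N} * {ffun 'I_n -> 'I_N} => [ffun x => (p.1 x, p.2 x)]).
      by move=> F _; apply/ffunP => x; rewrite !ffunE; case: (F x).
    by move=> [f1 f2] _; congr (_, _); apply/ffunP => x; rewrite !ffunE.
  apply: eq_big => [F|F _]; first by rewrite fixed_by_pair.
  have cB p : (inord (content F p) : 'I_B.+1) = content F p :> nat.
    rewrite inordK // ltnS (leq_trans _ nB) // -[leqRHS]card_ord; exact: max_card.
  rewrite /phi; congr (_ * _).
    congr (_%:~R); congr (\det _); apply: eq_slot => i; rewrite content_fst.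
    by apply: eq_bigr => j _; rewrite ffunE cB.
  apply: eq_bigr => j _; congr (_ ^+ _); rewrite content_snd.
  by apply: eq_bigr => i _; rewrite ffunE cB.
rewrite sum_fixed_content //; congr (_ *+ _).
rewrite hmat_family // big_mkcond /=.
transitivity (\sum_(A : {ffun 'I_N * 'I_N -> 'I_B.+1}) \sum_(w : 'S_N)
  (if [forall i, (\sum_j A (i, j) + stair (w i) == u i)%N] then
   (-1) ^+ w * \prod_j y j ^+ (\sum_i A (i, j))%N else 0)); last first.
  rewrite exchange_big /=; apply: eq_bigr => w _; rewrite big_distrr /=.
  by rewrite [RHS]big_mkcond.
apply: eq_bigr => A _; rewrite /phi.
(* If the total of [A] is not [n], no permutation can meet the row conditions, which force that
   total to be |u| minus the sum of the staircase. *)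
case: eqP => [sA|sA]; last first.
  rewrite big1 // => w _; case: forallP => // h; case: sA.
  have : (\sum_i \sum_j A (i, j) + \sum_(i < N) stair (w i) = n + \sum_(i < N) stair i)%N.
    by rewrite -su -big_split; apply: eq_bigr => i _; apply/eqP/h.
  rewrite [(\sum_(i < N) stair (w i))%N](_ : _ = \sum_(i < N) stair i)%N; last first.
    by rewrite [RHS](reindex_inj (@perm_inj _ w)).
  move/addIn => <-; rewrite pair_bigA /=; apply: eq_bigr => -[] //.
rewrite /determinant rmorph_sum big_distrl /=; apply: eq_bigr => w _.
rewrite rmorphM rmorphXn rmorphN1 rmorph_prod -mulrA.
case: forallP => h.
  rewrite [X in _ * (X * _)]big1 ?mul1r // => i _; rewrite mxE.
  by rewrite (h i) /= .
have /existsP [i hi] : [exists i, ~~ (\sum_j A (i, j) + stair (w i) == u i)%N].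
  by rewrite -negb_forall; apply/forallP.
by rewrite [X in _ * (X * _)](bigD1 i) //= mxE (negPf hi) !mul0r mulr0.
Qed.

End PowerSum.

Section Orthogonality.
Local Open Scope ring_scope.
Variables (n N : nat).

Let X (j : 'I_N) : {mpoly int[N]} := 'X_j.

Lemma mcoeff_prodX (e : 'I_N -> nat) (m : 'I_N -> nat) :
  (\prod_j X j ^+ e j)@_[multinom m i | i < N] = [forall i, e i == m i]%:R.
Proof.
have -> : \prod_j X j ^+ e j = 'X_[[multinom e i | i < N]].
  by rewrite mpolyXE_id; apply: eq_bigr => j _; rewrite mnmE.
rewrite mcoeffX; congr (nat_of_bool _)%:R.
apply/eqP/forallP => [/mnmP h i|h]; first by move: (h i); rewrite !mnmE => ->.
by apply/mnmP => i; rewrite !mnmE; apply/eqP.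
Qed.

Lemma det_powers (e : 'I_N -> nat) :
  \det (\matrix_(i, k) X k ^+ e i) = \sum_(w : 'S_N) (-1) ^+ w * \prod_j X j ^+ e (w j).
Proof.
rewrite -det_tr; apply: eq_bigr => w _; congr (_ * _).
by apply: eq_bigr => j _; rewrite !mxE.
Qed.

Lemma mcoeff_sign (b : bool) (p : {mpoly int[N]}) m : ((-1) ^+ b * p)@_m = (-1) ^+ b * p@_m.
Proof. by rewrite !mulr_sign; case: b; rewrite ?mcoeffN. Qed.

Lemma mcoeff_power_sum (m : 'I_N -> nat) (g : 'S_n) :
  (\det (\matrix_(i, k) X k ^+ @stair N i) * power_sum X g)@_[multinom m i | i < N] = chi m g.
Proof.
rewrite det_powers /power_sum /chi big_distrr /= raddf_sum; apply: eq_bigr => f _.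
rewrite big_distrl /= raddf_sum; apply: eq_bigr => w _.
rewrite -mulrA -big_split /= mcoeff_sign; congr (_ * _).
under eq_bigr => j _ do rewrite -exprD.
rewrite mcoeff_prodX; case: forallP => h.
  by rewrite big1 // => i _; rewrite mxE addnC (h i).
have /existsP [i hi] : [exists i, stair (w i) + content f i != m i]%N.
  by rewrite -negb_forall; apply/forallP.
by rewrite (bigD1 i) //= mxE addnC (negPf hi) mul0r.
Qed.

(** In [sum_chi_power_sum] times the Vandermonde determinant, the coefficient of y^m is read off
    twice: Frobenius' formula produces [chi m] on the left, and Jacobi-Trudi produces the alternant
    with exponents [u] on the right. *)
Lemma chi_orthogonal (u m : 'I_N -> nat) : (\sum_i u i = n + \sum_(i < N) stair i)%N ->
  \sum_(g : 'S_n) chi u g * chi m g = \det (\matrix_(i, j) (u i == m j)%:R) *+ n`!.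
Proof.
move=> su; pose B := (n + N + \sum_i u i)%N.
have uB i : (u i <= B)%N by rewrite /B (bigD1 i) //=; lia.
have NB : (N <= B)%N by rewrite /B; lia.
have := sum_chi_power_sum X uB (leq_trans (leq_addr _ _) (leq_addr _ _)) su.
move/(congr1 (fun p => (\det (\matrix_(i, k) X k ^+ @stair N i) * p)@_[multinom m i | i < N])).
rewrite mulrnAr det_hmat // big_distrr /= raddf_sum => e.
transitivity ((\det (\matrix_(i, k) X k ^+ u i) *+ n`!)@_[multinom m i | i < N]).
  rewrite -e; apply: eq_bigr => g _.
  by rewrite mulrCA mulrzl raddfMz /= mcoeff_power_sum mulrzz mulrC.
rewrite raddfMn /= det_powers raddf_sum /= -det_tr; congr (_ *+ _); apply: eq_bigr => w _.
rewrite mcoeff_sign mcoeff_prodX; congr (_ * _); case: forallP => h.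
  by rewrite big1 // => i _; rewrite !mxE (h i).
have /existsP [i hi] : [exists i, u (w i) != m i] by rewrite -negb_forall; apply/forallP.
by rewrite (bigD1 i) //= !mxE (negPf hi) mul0r.
Qed.

End Orthogonality.

(** * Young symmetrizers *)

Section Symmetrizer.
Local Open Scope ring_scope.
Variables (n : nat) (J K : finType).
Implicit Types (rho : {ffun 'I_n -> J}) (kap : {ffun 'I_n -> K}) (g t s x y : 'S_n).

(* The coefficient of [g] in the Young symmetrizer (signed column sum times row
   sum) of the filling which puts [x] in row [rho x] and column [kap x]. *)
Definition young rho kap g : int :=
  \sum_(t : 'S_n | fixed_by kap t && (relabel rho t == relabel rho g)) (-1) ^+ t.

Lemma fixed_byV (I : finType) (f : {ffun 'I_n -> I}) g : fixed_by f g -> relabel f g^-1%g = f.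
Proof. by move/eqP=> e; rewrite -{1}e relabelK. Qed.

Lemma fixed_byMl (I : finType) (f : {ffun 'I_n -> I}) t g :
  fixed_by f t -> fixed_by f (t * g)%g = fixed_by f g.
Proof.
move=> ft; rewrite /fixed_by relabelM; apply/eqP/eqP => [e|->]; last exact/eqP.
by rewrite -[LHS](relabelK _ t) e fixed_byV.
Qed.

Lemma fixed_by1 (I : finType) (f : {ffun 'I_n -> I}) : fixed_by f 1%g.
Proof. by rewrite /fixed_by relabel1. Qed.

Lemma fixed_by_tperm (I : finType) (f : {ffun 'I_n -> I}) (y z : 'I_n) : f y = f z -> fixed_by f (tperm y z).
Proof. by move=> e; apply/fixed_byP => x; case: tpermP => [->|->|]. Qed.

Lemma youngMr rho kap g s : fixed_by rho s -> young rho kap (g * s)%g = young rho kap g.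
Proof. by move=> /eqP rs; rewrite /young relabelM rs. Qed.

Lemma youngMl rho kap g t : fixed_by kap t ->
  young rho kap (t * g)%g = (-1) ^+ t * young rho kap g.
Proof.
move=> kt; rewrite /young (reindex_inj (mulgI t)) big_distrr /=.
apply: eq_big => [x|x _]; last by rewrite odd_permM signr_addb.
rewrite fixed_byMl // !relabelM; congr andb.
by apply/eqP/eqP => [/(congr1 (fun f => relabel f t^-1%g))|->//]; rewrite !relabelK.
Qed.

Lemma sum_young (R : pzRingType) rho kap (h : 'S_n -> R) :
  \sum_g (young rho kap g)%:~R * h g =
  \sum_(t | fixed_by kap t) \sum_(s | fixed_by rho s) (-1) ^+ t * h (t * s)%g.
Proof.
under eq_bigr => g _ do rewrite rmorph_sum big_distrl /=.
rewrite (exchange_big_dep (fixed_by kap)) /=; last by move=> g t _ /andP[].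
apply: eq_bigr => t kt; rewrite (reindex_inj (mulgI t)) /=.
apply: eq_big => [s|s _]; last by rewrite rmorph_sign.
rewrite kt /= relabelM /fixed_by eq_sym.
by apply/eqP/eqP => [/(congr1 (fun f => relabel f t^-1%g))|->//]; rewrite !relabelK.
Qed.

(** The transposition of [y] and [z] is both a row and a column permutation, and it reverses every
    sign. *)
Lemma young_repeat rho kap g (y z : 'I_n) : y != z -> rho y = rho z -> kap y = kap z -> young rho kap g = 0.
Proof.
move=> yz ry ky; pose t := tperm y z.
suff: young rho kap g = - young rho kap g by lia.
rewrite /young [LHS](reindex_inj (mulIg t)) -sumrN.
have ft (I : finType) (f : {ffun 'I_n -> I}) x : f y = f z -> relabel f (x * t)%g = relabel f x.
  by move=> fyz; rewrite relabelM (eqP (fixed_by_tperm fyz)).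
apply: eq_big => [x|x _]; first by rewrite /fixed_by !ft.
by rewrite odd_permM odd_tperm yz addbT signrN.
Qed.

Lemma young1 rho kap : (forall x y : 'I_n, rho x = rho y -> kap x = kap y -> x = y) ->
  young rho kap 1%g = 1.
Proof.
move=> inj; rewrite /young (big_pred1 1%g) ?odd_perm1 // => t /=.
rewrite relabel1; apply/andP/eqP => [[/fixed_byP kt /fixed_byP rt]|->].
  by apply/permP => x; rewrite perm1; apply: inj.
by rewrite relabel1 fixed_by1 eqxx.
Qed.

Variables (rho : {ffun 'I_n -> J}) (kap : {ffun 'I_n -> K}).
Let rows := #|[pred s | fixed_by rho s]|.
Let cols := #|[pred t | fixed_by kap t]|.

(* The symmetrizer [a b] (row sum times signed column sum) satisfies
   [a^2 = rows a] and [b^2 = cols b], so that [psi (a b)] is, up to the factor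
   [rows * cols], equal to [psi ((b a) (b a)^* )], a sum of squares. *)
Lemma sum_young_gram (I : finType) (psi : 'S_n -> algC) (v : I -> 'S_n -> algC) :
  (forall x y, psi (x * y)%g = psi (y * x)%g) ->
  (forall x y, psi (x * y^-1)%g = \sum_i v i x * (v i y)^*) ->
  \sum_i `|\sum_g (young rho kap g)%:~R * v i g| ^+ 2 =
  (\sum_g (young rho kap g)%:~R * psi g) *+ (rows * cols).
Proof.
move=> psiC gram.
transitivity (\sum_y (young rho kap y)%:~R * \sum_x (young rho kap x)%:~R * psi (x * y^-1)%g).
  under eq_bigr => i _.
    rewrite normCK rmorph_sum big_distrlr /=; over.
  rewrite exchange_big /=; under eq_bigr => x _ do rewrite exchange_big /=.
  rewrite exchange_big /=; apply: eq_bigr => y _; rewrite big_distrr /=; apply: eq_bigr => x _.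
  rewrite gram !big_distrr /=; apply: eq_bigr => i _.
  by rewrite rmorphM rmorph_int; ring.
rewrite sum_young /rows /cols mulrnA -sumr_const; apply: eq_bigr => t kt.
rewrite -sumr_const; apply: eq_bigr => s rs.
rewrite (reindex_inj (mulIg s)) (reindex_inj (mulgI t)) /= big_distrr /=.
apply: eq_bigr => x _; rewrite youngMr // youngMl // rmorphM rmorph_sign /= mulrA mulrA.
rewrite -signr_addb addbb mul1r; congr (_ * _).
by rewrite invMg !mulgA mulgK psiC !mulgA mulVg mul1g.
Qed.

End Symmetrizer.

Lemma perm_eq1_partial_sums N (w : 'S_N) :
  (forall r, \sum_(i < N | i < r) w i <= \sum_(i < N | i < r) i)%N -> w = 1%g.
Proof.
move=> h; apply/permP => i; rewrite perm1.
have [m mi] := ubnP i; elim: m i mi => // m IH i im.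
have IH' (j : 'I_N) : (j < i)%N -> w j = j by move=> ji; apply: IH; apply: leq_trans ji _.
apply/eqP; rewrite eq_sym -val_eqE eqn_leq; apply/andP; split.
  rewrite leqNgt; apply/negP => wi; have := IH' _ wi => /perm_inj e.
  by rewrite e ltnn in wi.
move: (h i.+1); rewrite (bigD1 i) //= [in X in (_ <= X)%N](bigD1 i) //=.
rewrite (eq_bigr (fun j : 'I_N => val j)); first by rewrite leq_add2r.
move=> j /andP[ji nij]; rewrite IH' // ltn_neqAle -ltnS ji andbT; exact: nij.
Qed.

(** * The symmetrizer of a bijective filling of a diagram *)

Section Tableau.
Local Open Scope ring_scope.
Variables (n N L : nat) (lam : 'I_N -> nat).
Hypothesis lam_decr : forall i j : 'I_N, (i <= j)%N -> (lam j <= lam i)%N.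
Hypothesis lamL : forall i, (lam i <= L)%N.
Variables (rho : {ffun 'I_n -> 'I_N}) (kap : {ffun 'I_n -> 'I_L}).
Hypothesis in_shape : forall x, (kap x < lam (rho x))%N.
Hypothesis filling_inj : forall x y, rho x = rho y -> kap x = kap y -> x = y.
Hypothesis filling_onto : forall (i : 'I_N) (j : 'I_L), (j < lam i)%N ->
  exists x, rho x = i /\ kap x = j.

Definition column_injective (f : {ffun 'I_n -> 'I_N}) :=
  [forall x, forall y, (x != y) && (kap x == kap y) ==> (f x != f y)].

Lemma column_injectiveP (f : {ffun 'I_n -> 'I_N}) : reflect (forall x y : 'I_n, kap x = kap y -> f x = f y -> x = y)
  (column_injective f).
Proof.
apply: (iffP forallP) => [h x y kxy fxy|h x].
  apply/eqP; move/forallP: (h x) => /(_ y); rewrite kxy fxy !eqxx andbT.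
  by case: (x == y).
apply/forallP => y; apply/implyP => /andP[nxy /eqP kxy].
by apply: contra nxy => /eqP fxy; apply/eqP/h.
Qed.

(** A column of the diagram is filled from the top. Either it meets all [r] rows of index less than
    [r], and [f], injective on it, takes at most [r] values there, or all its points lie in these
    rows. *)
Lemma column_count_le (f : {ffun 'I_n -> 'I_N}) c (r : nat) : column_injective f ->
  (#|[pred x | (kap x == c) && (f x < r)%N]| <= #|[pred x | (kap x == c) && (rho x < r)%N]|)%N.
Proof.
move=> /column_injectiveP finj.
case: (pickP [pred y | (kap y == c) && (r <= rho y)%N]) => [y0 /= /andP[/eqP ky0 ry0]|none].
  apply: (@leq_trans #|[pred i : 'I_N | (i < r)%N]|).
    rewrite -(card_in_imset (f := f)); last first.
      by move=> x y; rewrite !inE => /andP[/eqP kx _] /andP[/eqP ky _]; apply: finj; rewrite kx ky.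
    apply: subset_leq_card; apply/subsetP => i /imsetP [x]; rewrite !inE => /andP[_ fx] -> //.
  apply: leq_trans (leq_imset_card rho _); apply: subset_leq_card; apply/subsetP => i.
  rewrite inE => ir; have [|x [rx kx]] := @filling_onto i c.
    apply: leq_trans (lam_decr (leq_trans (ltnW ir) ry0)); rewrite -ky0; exact: in_shape.
  by apply/imsetP; exists x; rewrite ?inE ?kx ?eqxx ?rx.
apply: subset_leq_card; apply/subsetP => x; rewrite !inE => /andP[kx _].
by move: (none x); rewrite /= kx /= => /negbT; rewrite -ltnNge.
Qed.

Lemma sum_column_count (f : {ffun 'I_n -> 'I_N}) (r : nat) :
  (\sum_c #|[pred x | (kap x == c) && (f x < r)]| = \sum_(i < N | i < r) content f i)%N.
Proof.
transitivity #|[pred x | (f x < r)%N]|.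
  rewrite -sum1_card (partition_big kap xpredT) //=; apply: eq_bigr => c _.
  by rewrite sum1_card; apply: eq_card => x; rewrite [RHS]unfold_in !inE andbC.
rewrite -sum1_card (partition_big f (fun i : 'I_N => i < r)%N) //=; apply: eq_bigr => i ir.
rewrite sum1_card; apply: eq_card => x; rewrite [LHS]unfold_in !inE.
by case: eqP => [->|]; rewrite ?andbF // ir.
Qed.

Lemma content_tableau i : content rho i = lam i.
Proof.
rewrite /content -(card_in_imset (f := kap)); last first.
  by move=> x y; rewrite !inE => /eqP rx /eqP ry; apply: filling_inj; rewrite rx ry.
transitivity #|[pred j : 'I_L | (j < lam i)%N]|.
  apply: eq_card => j; rewrite [RHS]inE; apply/imsetP/idP => [[x]|/filling_onto [x [rx kx]]].
    by rewrite inE => /eqP <- ->.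
  by exists x => //; rewrite inE rx.
rewrite -sum1_card; under eq_bigl => j do rewrite inE.
by rewrite -(big_ord_widen _ (fun _ => 1%N) (lamL i)) sum1_card card_ord.
Qed.

(** Equality of the contents makes the columnwise inequalities add up to an equality, so each of
    them is one; [f] and [rho] then take the same values in every column. *)
Lemma column_injective_conj (f : {ffun 'I_n -> 'I_N}) :
  column_injective f -> content f =1 content rho ->
  exists2 t, fixed_by kap t & f = relabel rho t.
Proof.
move=> finj eqc.
have eqcol c r : #|[pred x | (kap x == c) && (f x < r)%N]| = #|[pred x | (kap x == c) && (rho x < r)%N]|.
  have: (\sum_c #|[pred x | (kap x == c) && (f x < r)]| =
         \sum_c #|[pred x | (kap x == c) && (rho x < r)]|)%N.
    by rewrite !sum_column_count; apply: eq_bigr => i _; rewrite eqc.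
  rewrite (bigD1 c) //= [in RHS](bigD1 c) //=.
  have ar (a a' b b' : nat) : (a <= a' -> b <= b' -> a + b = a' + b' -> a = a')%N by lia.
  apply: ar; first exact: column_count_le.
  by apply: leq_sum => i _; apply: column_count_le finj.
have cpair (h : {ffun 'I_n -> 'I_N}) i c : (content [ffun x => (h x, kap x)] (i, c) +
    #|[pred x | (kap x == c) && (h x < i)]| = #|[pred x | (kap x == c) && (h x < i.+1)]|)%N.
  rewrite /content -!sum1_card [RHS](bigID (fun x => h x == i)) /=; congr addn.
    apply: eq_bigl => x; rewrite !inE ffunE xpair_eqE andbC.
    by case: eqP => //= _; case: eqP => [->|]; rewrite ?andbF ?ltnS ?leqnn.
  apply: eq_bigl => x; rewrite !inE; case: eqP => //= _.
  by rewrite ltnS [RHS]andbC -val_eqE /= ltn_neqAle.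
have [|t Ht] := @content_conj _ _ [ffun x => (rho x, kap x)] [ffun x => (f x, kap x)].
  by move=> [i c]; apply/eqP; rewrite -(eqn_add2r #|[pred x | (kap x == c) && (rho x < i)%N]|) cpair -!eqcol cpair.
move/ffunP: Ht => Ht.
exists t; first by apply/fixed_byP => x; move: (Ht x); rewrite !ffunE => -[].
by apply/ffunP => x; move: (Ht x); rewrite !ffunE => -[].
Qed.

(* von Neumann's lemma: the Young symmetrizer spans the space of functions which
   are invariant under row permutations and alternating under column permutations. *)
Lemma young_unique (phi : 'S_n -> algC) :
  (forall t g s, fixed_by kap t -> fixed_by rho s -> phi (t * g * s)%g = (-1) ^+ t * phi g) ->
  forall g, phi g = phi 1%g * (young rho kap g)%:~R.
Proof.
move=> phiE g.
have yE t s g' : fixed_by kap t -> fixed_by rho s ->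
    (young rho kap (t * g' * s)%g)%:~R = (-1) ^+ t * (young rho kap g')%:~R :> algC.
  by move=> ft fs; rewrite youngMr // youngMl // rmorphM rmorph_sign.
(* Either [g] is a column permutation times a row permutation, or it sends two points of one column
   into one row. Their transposition is then a column permutation and its conjugate by [g] a row
   permutation, which forces both sides to vanish. *)
case: (boolP (column_injective (relabel rho g))) => [ci|].
  have [|t ft rt] := column_injective_conj ci; first exact: content_relabel.
  have fs : fixed_by rho (t^-1 * g)%g.
    by rewrite /fixed_by relabelM rt relabelK.
  have -> : g = (t * 1 * (t^-1 * g))%g by rewrite mulg1 mulKVg.
  rewrite phiE // yE // (young1 filling_inj) mulr1 mulrC //.
rewrite negb_forall => /existsP [y]; rewrite negb_forall => /existsP [z].
rewrite negb_imply negbK !ffunE => /andP[/andP[yz /eqP kyz] /eqP ryz].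
pose t := tperm y z; pose s := tperm (g y) (g z).
have gE : g = (t * g * s)%g.
  by rewrite /s -tpermJ -/t conjgE !mulgA mulgK tperm2 mul1g.
have ft : fixed_by kap t by apply: fixed_by_tperm.
have fs : fixed_by rho s by apply: fixed_by_tperm.
have neg1 (a : algC) : a = - a -> a = 0 by move=> e; apply/eqP; rewrite -eqNr -e.
have -> : phi g = 0 by apply: neg1; rewrite {1}gE phiE // odd_tperm yz expr1 mulN1r.
have -> : (young rho kap g)%:~R = 0 :> algC.
  by apply: neg1; rewrite {1}gE yE // odd_tperm yz expr1 mulN1r.
by rewrite mulr0.
Qed.

Let l (i : 'I_N) : nat := (lam i + stair i)%N.

(** The content of [f] has partial sums at most those of [lam]. In a nonzero term the permuted
    staircase makes up the difference, so the partial sums of [w] are at most those of the identity,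
    and [w] is the identity. *)
Lemma det_slot_tableau (f : {ffun 'I_n -> 'I_N}) : column_injective f ->
  \det (slot l (content f)) = [forall i, content f i == lam i]%:R.
Proof.
move=> finj.
rewrite /determinant (bigD1 1%g) //= odd_perm1 expr0 mul1r [X in _ + X]big1 ?addr0 => [|w w1]; last first.
  case: (pickP (fun i => content f i + stair (w i) != l i)%N) => [i ni|all].
    by rewrite (bigD1 i) //= mxE (negPf ni) mul0r mulr0.
  case/eqP: w1; apply: perm_eq1_partial_sums => r.
  have le : (\sum_(i < N | i < r) content f i <= \sum_(i < N | i < r) lam i)%N.
    rewrite -(eq_bigr _ (fun i _ => content_tableau i)) -!sum_column_count.
    by apply: leq_sum => c _; apply: column_count_le.
  have eq1 : (\sum_(i < N | i < r) content f i + \sum_(i < N | i < r) stair (w i) =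
          \sum_(i < N | i < r) lam i + \sum_(i < N | i < r) stair i)%N.
    rewrite -!big_split /=; apply: eq_bigr => i _.
    by move: (all i) => /negbFE/eqP.
  have eq2 : (\sum_(i < N | i < r) stair (w i) + \sum_(i < N | i < r) w i =
          \sum_(i < N | i < r) stair i + \sum_(i < N | i < r) i)%N.
    rewrite -!big_split /=; apply: eq_bigr => i _; rewrite /stair.
    by have := ltn_ord i; have := ltn_ord (w i); lia.
  have ar (a b c d e f' : nat) : (a <= b -> a + c = b + d -> c + e = d + f' -> e <= f')%N by lia.
  exact: ar le eq1 eq2.
case: forallP => h.
  by rewrite big1 // => i _; rewrite mxE perm1 /l (eqP (h i)) eqxx.
have /existsP [i hi] : [exists i, content f i != lam i] by rewrite -negb_forall; apply/forallP.
by rewrite (bigD1 i) //= mxE perm1 /l eqn_add2r (negPf hi) mul0r.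
Qed.

Lemma sum_young_fixed0 (f : {ffun 'I_n -> 'I_N}) : ~~ column_injective f ->
  \sum_(g | fixed_by f g) young rho kap g = 0.
Proof.
rewrite negb_forall => /existsP [y]; rewrite negb_forall => /existsP [z].
rewrite negb_imply negbK => /andP[/andP[yz /eqP kyz] /eqP fyz].
pose t := tperm y z.
have ft : fixed_by f t by apply: fixed_by_tperm.
have kt : fixed_by kap t by apply: fixed_by_tperm.
set S := \sum_(g | _) _.
suff : S = - S by lia.
rewrite {1}/S (reindex_inj (mulgI t)) -sumrN; apply: eq_big => [g|g _].
  by rewrite fixed_byMl.
by rewrite youngMl // odd_tperm yz expr1 mulN1r.
Qed.

(** A column transposition cancels the words that repeat a letter in a column, and the others only
    see the identity term of the determinant. Against the symmetrizer, [chi] thus acts as the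
    permutation character on the words of content [lam]. *)
Lemma sum_young_chi : \sum_g young rho kap g * chi l g =
  \sum_g young rho kap g *
    (#|[pred f : {ffun 'I_n -> 'I_N} | [forall i, content f i == lam i] && fixed_by f g]|)%:R.
Proof.
transitivity (\sum_(f : {ffun 'I_n -> 'I_N})
    \det (slot l (content f)) * \sum_(g | fixed_by f g) young rho kap g).
  under eq_bigr => g _ do rewrite /chi big_distrr /=.
  rewrite (exchange_big_dep xpredT) //=; apply: eq_bigr => f _; rewrite big_distrr /=.
  by apply: eq_bigr => g _; rewrite mulrC.
transitivity (\sum_(f : {ffun 'I_n -> 'I_N})
    [forall i, content f i == lam i]%:R * \sum_(g | fixed_by f g) young rho kap g).
  apply: eq_bigr => f _; case: (boolP (column_injective f)) => ci.
    by rewrite det_slot_tableau.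
  by rewrite sum_young_fixed0 // !mulr0.
under [RHS]eq_bigr => g _.
  rewrite -sum1_card big_mkcond natr_sum big_distrr /=.
  over.
rewrite [RHS]exchange_big /=; apply: eq_bigr => f _; rewrite big_distrr big_mkcond /=.
apply: eq_bigr => g _; rewrite inE.
by case: fixed_by; case: forallP; rewrite ?mulr1 ?mul1r ?mulr0 ?mul0r.
Qed.

End Tableau.

(** * Irreducible characters and Young symmetrizers *)

Section PermutationCharacter.
Local Open Scope ring_scope.
Variables (n : nat) (J : finType).

Definition perm_char (a : J -> nat) (g : 'S_n) : nat :=
  #|[pred f : {ffun 'I_n -> J} | [forall j, content f j == a j] && fixed_by f g]|.

(** Words of a given content form one orbit, so the character is induced from the trivial character
    of a stabilizer, or is zero when no word has content [a]. *)
Lemma perm_char_vchar a :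
  exists2 phi, phi \in 'Z[irr [set: 'S_n]]%g & forall g, phi g = (perm_char a g)%:R.
Proof.
case: (pickP (fun f : {ffun 'I_n -> J} => [forall j, content f j == a j])) => [f0 /forallP fa|none]; last first.
  exists 0; first exact: rpred0.
  by move=> g; rewrite cfunE /perm_char eq_card0 // => f; rewrite inE none.
have gH : group_set [set g | fixed_by f0 g].
  apply/group_setP; split=> [|x y]; rewrite !inE ?fixed_by1 // => fx fy.
  by rewrite fixed_byMl.
pose H := group gH.
exists ('Ind[[set: 'S_n]] (1 : 'CF(H))).
  by apply: cfInd_vchar; exact: cfun1_vchar.
move=> g; rewrite cfIndE ?subsetT //.
have := sum_relabel f0 (fun F => (fixed_by F g)%:R : algC).
rewrite (eq_bigr (fun F : {ffun 'I_n -> J} => (fixed_by F g)%:R *+ #|H|)); last first.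
  move=> F /forallP FE; congr (_ *+ _); rewrite (@card_fixed_content _ _ f0) => [|j]; last exact/eqP.
  by apply: eq_card => x; rewrite !inE.
rewrite sumrMnl => e.
rewrite (eq_bigr (fun h => (fixed_by (relabel f0 h) g)%:R)); last first.
  by move=> h _; rewrite cfun1E inE fixed_by_relabel.
rewrite (eq_bigl xpredT) => [|x]; last by rewrite inE.
rewrite e -[X in _ * X]mulr_natl mulKf ?neq0CG // /perm_char -sum1_card natr_sum.
rewrite big_mkcond [RHS]big_mkcond /=; apply: eq_bigr => f _; rewrite inE.
have -> : [forall j, content f j == content f0 j] = [forall j, content f j == a j].
  by apply: eq_forallb => j; rewrite (eqP (fa j)).
by case: fixed_by; case: forallP.
Qed.

End PermutationCharacter.

Section ChiVirtual.
Local Open Scope ring_scope.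
Variables (n N : nat).

Lemma chi_vchar (u : 'I_N -> nat) :
  exists2 phi, phi \in 'Z[irr [set: 'S_n]]%g & forall g, phi g = (chi u g)%:~R.
Proof.
have step (w : 'S_N) : exists2 phi, phi \in 'Z[irr [set: 'S_n]]%g &
    forall g, phi g = \sum_(f : {ffun 'I_n -> 'I_N} | fixed_by f g)
       [forall i, content f i + stair (w i) == u i]%N%:R.
  case: (pickP (fun f : {ffun 'I_n -> 'I_N} => [forall i, content f i + stair (w i) == u i]%N))
    => [f0 /forallP f0E|none]; last first.
    exists 0; first exact: rpred0.
    by move=> g; rewrite cfunE big1 // => f _; rewrite none.
  have [phi phiZ phiE] := perm_char_vchar n (content f0); exists phi => // g.
  rewrite phiE /perm_char -sum1_card natr_sum big_mkcond [RHS]big_mkcond /=.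
  apply: eq_bigr => f _; rewrite inE.
  have -> : [forall i, content f i == content f0 i] = [forall i, content f i + stair (w i) == u i]%N.
    by apply: eq_forallb => i; rewrite -(eqP (f0E i)) eqn_add2r.
  by case: fixed_by; case: forallP.
have /fin_all_exists2 [phi phiZ phiE] := step.
exists (\sum_(w : 'S_N) (-1) ^+ w *: phi w) => [|g].
  by apply: rpred_sum => w _; rewrite scaler_sign; case: (odd_perm w); rewrite ?rpredN phiZ.
rewrite sum_cfunE /chi rmorph_sum /=.
under eq_bigr => w _ do rewrite cfunE phiE big_distrr /=.
rewrite (exchange_big_dep (fun f : {ffun 'I_n -> 'I_N} => fixed_by f g)) //=; apply: eq_bigr => f ff.
rewrite /determinant rmorph_sum; apply: eq_big => [w|w _]; first by rewrite ff.
rewrite rmorphM rmorph_sign rmorph_prod; congr (_ * _).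
case: forallP => h; first by rewrite big1 // => i _; rewrite mxE (h i).
have /existsP [i hi] : [exists i, content f i + stair (w i) != u i]%N.
  by rewrite -negb_forall; apply/forallP.
by rewrite (bigD1 i) //= mxE (negPf hi) mul0r.
Qed.

End ChiVirtual.

Section IrrSymmetrizer.
Local Open Scope ring_scope.
Variables (n : nat) (J K : finType) (rho : {ffun 'I_n -> J}) (kap : {ffun 'I_n -> K}).

Let G := [set: 'S_n]%G.

Definition young_irr (i : Iirr G) : algC := \sum_g (young rho kap g)%:~R * 'chi_i g.

Lemma sum_setT (h : 'S_n -> algC) : \sum_(g in G) h g = \sum_g h g.
Proof. by apply: eq_bigl => g; rewrite inE. Qed.

Lemma irr_convolution (i j : Iirr G) (y : 'S_n) :
  \sum_z 'chi_i (z * y)%g * 'chi_j z^-1%g = #|G|%:R * ((i == j)%:R * ('chi_i y / 'chi_i 1%g)).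
Proof. by rewrite -generalized_orthogonality_relation mulVKf ?neq0CG // sum_setT. Qed.

Lemma cfunC (phi : 'CF(G)) (x y : 'S_n) : phi (x * y)%g = phi (y * x)%g.
Proof. by rewrite -[RHS](cfunJ _ _ (in_setT (x^-1)%g)) conjgE invgK !mulgA mulgK. Qed.

(** The convolution of an irreducible character with itself is |G| / ['chi_i 1] times that
    character, so ['chi_i (x * y^-1)] is a Gram kernel built from translates of ['chi_i], and
    [sum_young_gram] applies. The constant [c] absorbs the factor. *)
Lemma young_irr_ge0 i : 0 <= young_irr i.
Proof.
pose c := sqrtC ('chi_i 1%g / #|G|%:R).
have c2 : c * c^* = 'chi_i 1%g / #|G|%:R.
  have c0 : 0 <= c by rewrite sqrtC_ge0 divr_ge0 ?ler0n // char1_ge0 ?irr_char.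
  by rewrite geC0_conj // -expr2 sqrtCK.
have := @sum_young_gram n J K rho kap _ 'chi_i (fun (w x : 'S_n) => c * 'chi_i (w * x)%g) (cfunC 'chi_i).
move=> /(_ _) gram.
suff: 0 <= young_irr i *+ (#|[pred s | fixed_by rho s]| * #|[pred t | fixed_by kap t]|).
  rewrite pmulrn_lge0 // muln_gt0; apply/andP; split; apply/card_gt0P; exists 1%g;
  by rewrite inE fixed_by1.
rewrite /young_irr -gram => [|x y]; first by apply: sumr_ge0 => w _; rewrite exprn_ge0.
have := irr_convolution i i (x * y^-1)%g; rewrite eqxx mul1r.
have chi1 : 'chi_i 1%g != 0 by apply: irr1_neq0.
move/(congr1 (fun a => c * c^* * a)); rewrite {2}c2.
have cancel4 (F : fieldType) (a b d : F) : a != 0 -> b != 0 -> a / b * (b * (d / a)) = d.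
  by move=> a0 b0; field; rewrite a0 b0.
rewrite cancel4 ?neq0CG // => <-.
rewrite (reindex_inj (mulgI y)) /= big_distrr /=; apply: eq_bigr => w _.
rewrite rmorphM mulrACA; congr (_ * (_ * _)).
  by rewrite !mulgA cfunC -!mulgA mulKg.
by rewrite irr_inv cfunC.
Qed.

End IrrSymmetrizer.

Section ShapeSum.
Local Open Scope ring_scope.
Variables (n N L : nat).

Definition row_of (T : {ffun 'I_n -> 'I_N * 'I_L}) : {ffun 'I_n -> 'I_N} := [ffun x => (T x).1].
Definition col_of (T : {ffun 'I_n -> 'I_N * 'I_L}) : {ffun 'I_n -> 'I_L} := [ffun x => (T x).2].

Definition in_diagram (lam : 'I_N -> nat) (T : {ffun 'I_n -> 'I_N * 'I_L}) : bool :=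
  [forall x, (T x).2 < lam (T x).1]%N.

Definition young_sum (lam : 'I_N -> nat) (g : 'S_n) : int :=
  \sum_(T | in_diagram lam T) young (row_of T) (col_of T) g.

Lemma young_relabel (J K : finType) (rho : {ffun 'I_n -> J}) (kap : {ffun 'I_n -> K}) h g :
  young (relabel rho h) (relabel kap h) g = young rho kap (g ^ h)%g.
Proof.
rewrite /young [RHS](reindex_inj (conjg_inj h)) /=.
apply: eq_big => [t|t _]; last by rewrite odd_permJ.
rewrite fixed_by_relabel; congr andb; rewrite !conjgE !relabelM.
by apply/eqP/eqP => [->//|/(congr1 (fun f => relabel f h))]; rewrite -!(relabelM _ h) !mulgV !relabel1.
Qed.

Lemma young_not_inj (T : {ffun 'I_n -> 'I_N * 'I_L}) g :
  ~~ injectiveb T -> young (row_of T) (col_of T) g = 0.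
Proof.
move/injectivePn => [y [z yz e]].
by apply: (@young_repeat _ _ _ _ _ _ y z) => //; rewrite !ffunE e.
Qed.

End ShapeSum.

Section ChiIrreducible.
Local Open Scope ring_scope.
Variables (n N L : nat) (lam : 'I_N -> nat).
Hypothesis lam_decr : forall i j : 'I_N, (i <= j)%N -> (lam j <= lam i)%N.
Hypothesis lamL : forall i, (lam i <= L)%N.
Variables (rho : {ffun 'I_n -> 'I_N}) (kap : {ffun 'I_n -> 'I_L}).
Hypothesis in_shape : forall x, (kap x < lam (rho x))%N.
Hypothesis filling_inj : forall x y, rho x = rho y -> kap x = kap y -> x = y.
Hypothesis filling_onto : forall (i : 'I_N) (j : 'I_L), (j < lam i)%N ->
  exists x, rho x = i /\ kap x = j.

Let G := [set: 'S_n]%G.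
Let l (i : 'I_N) : nat := (lam i + stair i)%N.
Let S := young_irr rho kap.

(** The signed sum [phi] of two-sided translates of ['chi_i] has the symmetry required by
    [young_unique], so it is [S i] times the symmetrizer. Its pairing with the conjugate of ['chi_j]
    is [S i * S j], and it is 0 by orthogonality. *)
Lemma irr_symmetrizer_unique (i j : Iirr G) : i != j -> S i * S j = 0.
Proof.
move=> ij.
pose phi (g : 'S_n) : algC := \sum_(t | fixed_by kap t) \sum_(s | fixed_by rho s)
   (-1) ^+ t * 'chi_i (t * g * s)%g.
have phi1 : phi 1%g = S i.
  rewrite /S /young_irr sum_young; apply: eq_bigr => t _; apply: eq_bigr => s _.
  by rewrite mulg1.
have phiE : forall t g s, fixed_by kap t -> fixed_by rho s -> phi (t * g * s)%g = (-1) ^+ t * phi g.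
  move=> t g s ft fs; rewrite /phi [LHS](reindex_inj (mulIg t^-1%g)) big_distrr /=.
  have fV (I : finType) (f : {ffun 'I_n -> I}) x : fixed_by f x -> fixed_by f x^-1%g.
    by move=> fx; rewrite /fixed_by fixed_byV.
  have fMr (I : finType) (f : {ffun 'I_n -> I}) x y : fixed_by f y -> fixed_by f (x * y)%g = fixed_by f x.
    by move=> /eqP fy; rewrite /fixed_by relabelM fy.
  apply: eq_big => [x|x _]; first by rewrite fMr // fV.
  rewrite (reindex_inj (mulgI s^-1%g)) big_distrr /=.
  apply: eq_big => [y|y _]; first by rewrite fixed_byMl // fV.
  rewrite odd_permM odd_permV signr_addb mulrA [(-1) ^+ x * _]mulrC; congr (_ * 'chi_i _).
  by rewrite !mulgA mulgKV mulgK.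
have phiy := young_unique lam_decr in_shape filling_inj filling_onto phiE.
have S_real k : (S k)^* = S k by rewrite geC0_conj // young_irr_ge0.
rewrite -[S j]S_real -phi1 /S /young_irr rmorph_sum big_distrr /=.
under eq_bigr => g _.
  rewrite rmorphM rmorph_int /= -irr_inv mulrA -phiy /phi big_distrl /=; over.
rewrite exchange_big big1 //= => t _.
under eq_bigr => g _ do rewrite big_distrl /=.
rewrite exchange_big big1 //= => s _.
under eq_bigr => g _ do rewrite -mulgA cfunC -mulgA -mulrA.
by rewrite -big_distrr /= irr_convolution (negPf ij) mul0r mulr0 mulr0.
Qed.

(** The entries [v] of the permutation matrices give the character a Gram form. The diagonal entry
    at [rho] alone contributes a positive square: paired with the symmetrizer it counts the row
    permutations. *)
Lemma sum_young_perm_char_gt0 :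
  0 < \sum_g (young rho kap g)%:~R * (perm_char lam g)%:R :> algC.
Proof.
pose F := {ffun 'I_n -> 'I_N}.
pose v (p : F * F) (x : 'S_n) : algC :=
  ([forall i, content p.1 i == lam i] && (relabel p.1 x == p.2))%:R.
have := @sum_young_gram n _ _ rho kap _ (fun g => (perm_char lam g)%:R) v.
move=> /(_ _ _) gram.
suff: 0 < (\sum_g (young rho kap g)%:~R * (perm_char lam g)%:R : algC) *+
     (#|[pred s | fixed_by rho s]| * #|[pred t | fixed_by kap t]|).
  rewrite pmulrn_lgt0 // muln_gt0; apply/andP; split; apply/card_gt0P; exists 1%g;
  by rewrite inE fixed_by1.
rewrite -gram.
- rewrite (bigD1 (rho, rho)) //=; apply: ltr_wpDr.
    by apply: sumr_ge0 => p _; rewrite exprn_ge0.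
  rewrite exprn_gt0 // normr_gt0 /v /= .
  have -> : [forall i, content rho i == lam i].
    by apply/forallP => i; apply/eqP/(content_tableau lamL in_shape filling_inj filling_onto).
  rewrite (eq_bigr (fun g : 'S_n => (fixed_by rho g)%:R)) => [|g _]; last first.
    rewrite /fixed_by; case: eqP => [rg|_]; last by rewrite mulr0.
    by rewrite mulr1 -[g]mul1g youngMr ?(young1 filling_inj) // /fixed_by rg.
  rewrite -natr_sum pnatr_eq0 -lt0n (bigD1 1%g) //= fixed_by1 //.
- by move=> x y; have [phi _ phiE] := perm_char_vchar n lam; rewrite -!phiE cfunC.
move=> x y; rewrite -(pair_bigA _ (fun h h' => v (h, h') x * (v (h, h') y)^*)) /=.
rewrite /perm_char -sum1_card natr_sum big_mkcond /=.
rewrite (reindex_inj (h := fun f : F => relabel f y)) /=; last first.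
  by move=> f f' /(congr1 (fun f => relabel f (y^-1)%g)); rewrite !relabelK.
apply: eq_bigr => h _; rewrite (bigD1 (relabel h x)) //= big1 ?addr0; last first.
  by move=> h' /negPf nh; rewrite /v /= [_ == h']eq_sym nh andbF mul0r.
rewrite /v /= inE /fixed_by relabelM relabelK eqxx andbT [relabel h y == _]eq_sym.
have -> : [forall j, content (relabel h y) j == lam j] = [forall j, content h j == lam j].
  by apply: eq_forallb => j; rewrite content_relabel.
by rewrite rmorph_nat -natrM mulnb; case: forallP; case: eqP.
Qed.

Lemma chi_irr : exists i : Iirr G, (forall g, 'chi_i g = (chi l g)%:~R) /\ S i != 0.
Proof.
have [phi phiZ phiE] := chi_vchar n l.
have sl : (\sum_i l i = n + \sum_(i < N) stair i)%N.
  rewrite big_split /= -(content_sum rho); congr addn; apply: eq_bigr => i _.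
  by rewrite (content_tableau lamL in_shape filling_inj filling_onto).
have l_inj i j : l i = l j -> i = j.
  move=> e; apply/val_inj => /=; move: e; rewrite /l /stair.
  have := ltn_ord i; have := ltn_ord j.
  by case: (ltngtP i j) => // [/[dup] /ltnW /lam_decr|/[dup] /ltnW /lam_decr]; lia.
have phi_norm : '[phi] = 1.
  rewrite cfdotE (eq_bigl xpredT) => [|g]; last by rewrite inE.
  rewrite (eq_bigr (fun g => (chi l g * chi l g)%:~R)) => [|g _]; last first.
    by rewrite phiE rmorphM rmorph_int.
  rewrite -rmorph_sum /= chi_orthogonal // (_ : \matrix_(i, j) _ = 1%:M); last first.
    apply/matrixP => i j; rewrite !mxE; congr (nat_of_bool _)%:R.
    by apply/eqP/eqP => [/l_inj|->].
  rewrite det1 cardsT; have -> : #|{: 'S_n}| = n`! by rewrite -card_Sn; apply: eq_card.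
  by rewrite rmorphMn /= mulVf // pnatr_eq0 -lt0n fact_gt0.
have [b [i phi_i]] := vchar_norm1P phiZ phi_norm.
(* This excludes the sign -1, because [S i] is nonnegative, and also shows that [S i] is not
   zero. *)
have pos : 0 < \sum_g (young rho kap g)%:~R * phi g.
  rewrite (eq_bigr (fun g => (young rho kap g * chi l g)%:~R)) => [|g _]; last by rewrite phiE rmorphM.
  have := sum_young_perm_char_gt0.
  rewrite -[X in _ -> 0 < X]rmorph_sum /= (sum_young_chi lam_decr lamL in_shape filling_inj filling_onto).
  rewrite rmorph_sum; congr (0 < _); apply: eq_bigr => g _; rewrite rmorphM /=.
  by rewrite rmorph_nat.
have Si : \sum_g (young rho kap g)%:~R * phi g = (-1) ^+ b * S i.
  rewrite phi_i big_distrr /=; apply: eq_bigr => g _.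
  by rewrite cfunE mulrCA.
rewrite Si in pos.
exists i; split=> [g|]; last by apply: contraL pos => /eqP ->; rewrite mulr0 ltxx.
rewrite -phiE phi_i; case: b pos {Si phi_i} => [|_]; last by rewrite scale1r.
rewrite expr1 mulN1r oppr_gt0 => neg; have := young_irr_ge0 rho kap i; rewrite -/(S i).
by move=> ge0; move: (le_lt_trans ge0 neg); rewrite ltxx.
Qed.

Let T0 : {ffun 'I_n -> 'I_N * 'I_L} := [ffun x => (rho x, kap x)].

Lemma filling_content (T : {ffun 'I_n -> 'I_N * 'I_L}) :
  injective T -> in_diagram lam T -> content T =1 content T0.
Proof.
move=> Tinj /forallP Tin.
have le c : (content T c <= content T0 c)%N.
  apply: (@leq_trans (c.2 < lam c.1)%N).
    case: (ltnP c.2 (lam c.1)) => cl.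
      rewrite /content -(card_in_imset (f := T)) => [|x y _ _ /Tinj //].
      rewrite -[nat_of_bool true](cards1 c); apply: subset_leq_card; apply/subsetP => d /imsetP [x].
      by rewrite !inE => /eqP <- ->.
    rewrite leqn0; apply/eqP/eq_card0 => x; rewrite !inE; apply/negP => /eqP e.
    by have := Tin x; rewrite e ltnNge cl.
  case: c => i j /=; case: ltnP => // /filling_onto [x [rx kx]].
  by apply/card_gt0P; exists x; rewrite inE ffunE rx kx.
have e : (\sum_c content T c = \sum_c content T0 c)%N by rewrite !content_sum.
move=> c; apply/eqP; rewrite eqn_leq le /= leqNgt; apply/negP => lt.
have : (\sum_c content T c < \sum_c content T0 c)%N.
  rewrite (bigD1 c) //= [in X in (_ < X)%N](bigD1 c) //= -addSn leq_add //.
  by apply: leq_sum => d _.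
by rewrite e ltnn.
Qed.

(** The injective fillings are the relabelings of the given bijective one, whose stabilizer is
    trivial; the others contribute nothing. *)
Lemma young_sum_conj g : young_sum L lam g = \sum_h young rho kap (g ^ h)%g.
Proof.
have stab (F : {ffun 'I_n -> 'I_N * 'I_L}) : content F =1 content T0 ->
    #|[pred g | fixed_by F g]| = 1%N.
  move=> /card_fixed_content ->; rewrite -(card1 (1 : 'S_n)%g); apply: eq_card => h; rewrite !inE.
  apply/fixed_byP/eqP => [fh|->]; last by move=> x; rewrite perm1.
  apply/permP => x; rewrite perm1; move: (fh x); rewrite !ffunE => -[].
  exact: filling_inj.
have := sum_relabel T0 (fun F => young (row_of F) (col_of F) g).
rewrite (eq_bigr (fun h => young rho kap (g ^ h)%g)) => [->|h _]; last first.
  rewrite -young_relabel; congr young; apply/ffunP => x; by rewrite !ffunE.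
rewrite /young_sum big_mkcond [RHS]big_mkcond /=; apply: eq_bigr => F _.
case: (boolP (injectiveb F)) => [/injectiveP Finj|ni]; last first.
  by rewrite young_not_inj // mul0rn !if_same.
case: forallP => [/(_ _) FE|FE].
  have cF : content F =1 content T0 by move=> j; apply/eqP.
  rewrite stab // ifT //; apply/forallP => x.
  have [h ->] := @content_conj _ _ T0 F (fun j => esym (cF j)).
  by rewrite !ffunE; apply: in_shape.
case: ifP => // Fin; case: FE => j; apply/eqP; exact: filling_content.
Qed.

(** The sum of the conjugates of a symmetrizer is a class function [Y] with coordinates [S j]. Only
    one of these is nonzero, so [Y] is a multiple of [chi]; its value n! at 1 determines the
    factor. *)
Lemma chi_young_sum (g : 'S_n) : chi l (1%g : 'S_n) * young_sum L lam g = n`!%:R * chi l g.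
Proof.
have [i [iE Si]] := chi_irr.
apply: (@intr_inj algC); rewrite !rmorphM rmorph_nat /= -!iE.
pose y (g : 'S_n) : algC := (young_sum L lam g)%:~R.
have yJ : {in G &, forall x z, y (x ^ z)%g = y x}.
  move=> x z _ _; rewrite /y !young_sum_conj; congr _%:~R.
  by rewrite (reindex_inj (mulgI z^-1)%g) /=; apply: eq_bigr => h _; rewrite -conjgM mulKVg.
have y0 x : x \notin G -> y x = 0 by rewrite inE.
have yf : is_class_fun <<G>>%g [ffun x => y x] by rewrite genGid; exact: intro_class_fun.
pose Y : 'CF(G) := Cfun 0 yf.
have YE x : Y x = y x by rewrite cfunE ?ffunE.
have Ydot j : '[Y, 'chi_j] = S j.
  have S_real k : (S k)^* = S k by rewrite geC0_conj // young_irr_ge0.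
  rewrite cfdotE sum_setT -[S j]S_real /S /young_irr rmorph_sum.
  under eq_bigr => x _ do rewrite YE /y young_sum_conj rmorph_sum big_distrl /=.
  rewrite exchange_big /=.
  rewrite (eq_bigr (fun=> \sum_g ((young rho kap g)%:~R * 'chi_j g)^* )) => [|h _].
    rewrite sumr_const -[X in _ * X = _]mulr_natl mulrA; have -> : #|{: 'S_n}| = #|G| by rewrite cardsT.
    by rewrite mulVf ?mul1r // neq0CG.
  rewrite (reindex_inj (conjg_inj (h^-1)%g)) /=; apply: eq_bigr => x _.
  by rewrite conjgKV rmorphM rmorph_int cfunJ ?inE.
have Yi : Y = S i *: 'chi_i.
  rewrite [Y]cfun_sum_cfdot (bigD1 i) //= big1 ?addr0 ?Ydot // => j ji.
  have := irr_symmetrizer_unique ji; rewrite -Ydot => /eqP.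
  by rewrite mulf_eq0 (negPf Si) orbF => /eqP ->; rewrite scale0r.
have := YE g; have := YE 1%g; rewrite Yi !cfunE /y => e1 eg.
rewrite -eg mulrA [_ * S i]mulrC e1; congr (_ * _).
rewrite young_sum_conj (eq_bigr (fun=> 1)) => [|h _]; last by rewrite conj1g (young1 filling_inj).
rewrite sumr_const; have -> : #|{: 'S_n}| = n`! by rewrite -card_Sn; apply: eq_card.
by rewrite rmorph_nat.
Qed.

Lemma chi1_neq0 : chi l (1%g : 'S_n) != 0.
Proof.
have [i [iE _]] := chi_irr.
by rewrite -(intr_eq0 algC) -iE irr1_neq0.
Qed.

Lemma sum_young_chi_ge0 (J K : finType) (rho' : {ffun 'I_n -> J}) (kap' : {ffun 'I_n -> K}) :
  0 <= \sum_g young rho' kap' g * chi l g.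
Proof.
have [i [iE _]] := chi_irr; have := young_irr_ge0 rho' kap' i.
rewrite /young_irr -(ler0z algC) rmorph_sum; congr (0 <= _).
by apply: eq_bigr => g _; rewrite iE rmorphM.
Qed.

End ChiIrreducible.

Section Diagram.
Local Open Scope ring_scope.
Variables (N : nat) (lam : 'I_N -> nat).
Hypothesis lam_decr : forall i j : 'I_N, (i <= j)%N -> (lam j <= lam i)%N.

Definition diagram L : {set 'I_N * 'I_L} := [set c : 'I_N * 'I_L | (c.2 < lam c.1)%N].

Lemma card_diagram L : (forall i, lam i <= L)%N -> #|diagram L| = (\sum_i lam i)%N.
Proof.
move=> lamL; rewrite -sum1_card (partition_big fst xpredT) //=; apply: eq_bigr => i _.
rewrite (reindex_onto (fun j : 'I_L => (i, j)) snd) /=; last first.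
  by move=> [i' j] /= /andP[_ /eqP <-].
rewrite (eq_bigl (fun j : 'I_L => (j < lam i)%N)) => [|j]; last by rewrite inE /= !eqxx !andbT.
by rewrite -(big_ord_widen _ (fun _ => 1%N) (lamL i)) sum1_card card_ord.
Qed.

Lemma filling_exists n L : (forall i, lam i <= L)%N -> n = (\sum_i lam i)%N ->
  exists (rho : {ffun 'I_n -> 'I_N}) (kap : {ffun 'I_n -> 'I_L}),
  [/\ forall x : 'I_n, (kap x < lam (rho x))%N,
      forall x y : 'I_n, rho x = rho y -> kap x = kap y -> x = y &
      forall (i : 'I_N) (j : 'I_L), (j < lam i)%N -> exists x, rho x = i /\ kap x = j].
Proof.
move=> lamL nE; have cD : #|diagram L| = n by rewrite card_diagram.
pose e x := enum_val (cast_ord (esym cD) x).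
exists [ffun x => (e x).1], [ffun x => (e x).2]; split.
- by move=> x; rewrite !ffunE; have := enum_valP (cast_ord (esym cD) x); rewrite inE.
- move=> x y; rewrite !ffunE => e1 e2.
  have : e x = e y by case: (e x) (e y) e1 e2 => [? ?] [? ?] /= -> ->.
  by move/enum_val_inj/cast_ord_inj.
move=> i j ij; have D : (i, j) \in diagram L by rewrite inE.
exists (cast_ord cD (enum_rank_in D (i, j))).
by rewrite !ffunE /e cast_ordK enum_rankK_in.
Qed.

Let l (i : 'I_N) : nat := (lam i + stair i)%N.

Lemma lam_le_sum i : (lam i <= \sum_i lam i)%N.
Proof. by rewrite (bigD1 i) //= leq_addr. Qed.

Lemma chi_ratio n L (g : 'S_n) : (forall i, lam i <= L)%N -> n = (\sum_i lam i)%N ->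
  chi l (1%g : 'S_n) * young_sum L lam g = n`!%:R * chi l g.
Proof.
move=> lamL nE; have [rho [kap [h1 h2 h3]]] := filling_exists lamL nE.
exact: chi_young_sum h1 h2 h3 g.
Qed.

Lemma chi_unit_neq0 n : n = (\sum_i lam i)%N -> chi l (1%g : 'S_n) != 0.
Proof.
move=> nE; have [rho [kap [h1 h2 h3]]] := filling_exists lam_le_sum nE.
exact: (chi1_neq0 lam_decr lam_le_sum h1 h2 h3).
Qed.

Lemma young_chi_ge0 n (J K : finType) (rho : {ffun 'I_n -> J}) (kap : {ffun 'I_n -> K}) :
  n = (\sum_i lam i)%N -> 0 <= \sum_g young rho kap g * chi l g.
Proof.
move=> nE; have [rho' [kap' [h1 h2 h3]]] := filling_exists lam_le_sum nE.
exact: (sum_young_chi_ge0 lam_decr lam_le_sum h1 h2 h3).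
Qed.

End Diagram.

(** * Restriction to smaller symmetric groups *)

Section Restriction.
Local Open Scope ring_scope.

Notation lift0 g := (lift_perm ord0 ord0 g).

Definition ffun_cons n (J : Type) (j : J) (f : {ffun 'I_n -> J}) : {ffun 'I_n.+1 -> J} :=
  [ffun x => if unlift ord0 x is Some y then f y else j].

Lemma ffun_cons0 n J (j : J) (f : {ffun 'I_n -> J}) : ffun_cons j f ord0 = j.
Proof. by rewrite ffunE unlift_none. Qed.

Lemma ffun_consS n J (j : J) (f : {ffun 'I_n -> J}) x : ffun_cons j f (lift ord0 x) = f x.
Proof. by rewrite ffunE liftK. Qed.

Lemma sum_ffun_cons (R : nmodType) n (J : finType) (F : {ffun 'I_n.+1 -> J} -> R) :
  \sum_f F f = \sum_f \sum_j F (ffun_cons j f).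
Proof.
rewrite pair_big /=.
rewrite (reindex (fun p : {ffun 'I_n -> J} * J => ffun_cons p.2 p.1)) //=.
exists (fun f : {ffun 'I_n.+1 -> J} => ([ffun x => f (lift ord0 x)], f ord0)).
  move=> [f j] _; congr (_, _); last by rewrite ffun_cons0.
  by apply/ffunP => x; rewrite ffunE ffun_consS.
move=> f _; apply/ffunP => x; case: (unliftP ord0 x) => [y ->|->].
  by rewrite ffun_consS ffunE.
by rewrite ffun_cons0.
Qed.

Lemma content_cons n (J : finType) (j : J) (f : {ffun 'I_n -> J}) i :
  content (ffun_cons j f) i = ((j == i) + content f i)%N.
Proof.
rewrite /content -!sum1_card [LHS]big_mkcond [X in (_ + X)%N]big_mkcond big_ord_recl /=; congr addn.
  by rewrite inE ffun_cons0; case: (j == i).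
by apply: eq_bigr => x _; rewrite !inE ffun_consS.
Qed.

Lemma fixed_by_cons n (J : finType) (j : J) (f : {ffun 'I_n -> J}) g :
  fixed_by (ffun_cons j f) (lift0 g) = fixed_by f g.
Proof.
apply/fixed_byP/fixed_byP => fg x.
  by have := fg (lift ord0 x); rewrite lift_perm_lift !ffun_consS.
case: (unliftP ord0 x) => [y ->|->]; last by rewrite lift_perm_id.
by rewrite lift_perm_lift !ffun_consS.
Qed.

Variable N : nat.

Definition decr (u : 'I_N -> nat) (i : 'I_N) (a : 'I_N) : nat := (u a - (a == i))%N.

(** The branching rule: a word on [n.+1] points is a letter [i] at the fixed point and a word on the
    others, and that letter lowers by one the exponent which row [i] of the slot matrix still has to
    reach. *)
Lemma chi_lift n (u : 'I_N -> nat) (g : 'S_n) :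
  chi u (lift0 g) = \sum_(i | (0 < u i)%N) chi (decr u i) g.
Proof.
rewrite /chi big_mkcond sum_ffun_cons.
under [RHS]eq_bigr => i _ do rewrite big_mkcond.
rewrite [RHS]exchange_big /=; apply: eq_bigr => f _.
rewrite [RHS]big_mkcond; apply: eq_bigr => i _.
rewrite fixed_by_cons; case: ifP => _; last by rewrite if_same.
case: posnP => ui.
  rewrite (expand_det_row _ i) big1 // => j _.
  by rewrite mxE content_cons eqxx ui mul0r.
congr (\det _); apply/matrixP => a j; rewrite !mxE content_cons /decr; congr (nat_of_bool _)%:R.
by rewrite [i == a]eq_sym; case: (altP (a =P i)) => [->|_]; rewrite ?subn0 //; apply/idP/idP => /eqP ?; apply/eqP; lia.
Qed.

Lemma sum_decr u i : (0 < u i)%N -> (\sum_a decr u i a).+1 = (\sum_a u a)%N.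
Proof.
move=> ui; rewrite (bigD1 i) //= [RHS](bigD1 i) //= /decr eqxx.
rewrite (eq_bigr u) => [|a /negPf ->]; last by rewrite subn0.
lia.
Qed.

(* The image of ['S_k] is the pointwise stabilizer of the first [j] points. *)
Fixpoint shift_perm j k (g : 'S_k) : 'S_(j + k) :=
  if j is j'.+1 then lift0 (shift_perm j' g) else g.

(* [(|u| - |m|)! * skew_det m u] is the number of standard tableaux of skew shape. *)
Definition skew_det (m u : 'I_N -> nat) : rat :=
  \det (\matrix_(i, j) if (m j <= u i)%N then ((u i - m j)`!)%:R^-1 else 0).

(** The factor u_i - m_b turns 1/(u_i - m_b)! into 1/(u_i - 1 - m_b)!. In each term of the
    determinant these factors, summed over the rows, give |u| - |m| = j + 1. *)
Lemma skew_det_rec (m u : 'I_N -> nat) j : (\sum_i u i = \sum_i m i + j.+1)%N ->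
  j.+1%:R * skew_det m u = \sum_(i | (0 < u i)%N) skew_det m (decr u i).
Proof.
move=> su.
pose A i b : rat := if (m b <= u i)%N then ((u i - m b)`!)%:R^-1 else 0.
have fact_step i b : (if (m b <= u i)%N then (u i - m b)%:R else 0) * A i b =
    (if (m b < u i)%N then ((u i - (m b).+1)`!)%:R^-1 else 0).
  rewrite /A; case: (ltngtP (m b) (u i)) => [lt|_|->]; rewrite ?mul0r ?subnn ?mul0r //.
  have -> : (u i - m b = (u i - (m b).+1).+1)%N by lia.
  by rewrite factS natrM invfM mulrA divff ?mul1r ?pnatr_eq0.
pose d (a b : 'I_N) : rat := (u a)%:R - (m b)%:R.
have dA a b : d a b * A a b = (if (m b < u a)%N then ((u a - (m b).+1)`!)%:R^-1 else 0).
  rewrite -fact_step /A /d; case: leqP => mu; last by rewrite !mulr0.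
  by rewrite natrB.
transitivity (\sum_(i < N) \det (\matrix_(a < N, b < N) ((if a == i then d i b else 1) * A a b))).
  rewrite /skew_det /determinant exchange_big big_distrr /=; apply: eq_bigr => w _.
  rewrite mulrCA; rewrite -big_distrr /=; congr (_ * _).
  rewrite [RHS](eq_bigr (fun i => d i (w i) * \prod_a A a (w a))) => [|i _]; last first.
    rewrite (bigD1 i) //= [in RHS](bigD1 i) //= !mxE eqxx mulrA; congr (_ * _).
    by apply: eq_bigr => a /negPf ai; rewrite mxE ai mul1r.
  rewrite -big_distrl /= /d big_split /= sumrN -!natr_sum.
  rewrite [X in _ - X%:R](_ : _ = \sum_i m i)%N; last by rewrite [RHS](reindex_inj (@perm_inj _ w)).
  rewrite su natrD addrC addKr; congr (_ * _); apply: eq_bigr => i _; by rewrite mxE.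
rewrite [RHS]big_mkcond /=; apply: eq_bigr => i _; case: posnP => ui.
  rewrite (expand_det_row _ i) big1 // => b _.
  by rewrite mxE eqxx dA ui ltn0 mul0r.
congr (\det _); apply/matrixP => a b; rewrite !mxE /decr; case: eqP => [->|_].
  rewrite dA /=; have -> : (m b <= u i - 1)%N = (m b < u i)%N by apply/idP/idP; lia.
  by have -> : (u i - 1 - m b = u i - (m b).+1)%N by lia.
by rewrite subn0 mul1r.
Qed.

Lemma skew_det_eq_size (m u : 'I_N -> nat) : (\sum_i u i = \sum_i m i)%N ->
  skew_det m u = \det (\matrix_(i, j) (u i == m j)%:R).
Proof.
move=> su; apply: eq_bigr => w _; congr (_ * _).
have sw : (\sum_i m (w i) = \sum_i u i)%N by rewrite su [RHS](reindex_inj (@perm_inj _ w)).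
case: (boolP [forall i, m (w i) <= u i]%N) => [/forallP le|].
  have eqm i : m (w i) = u i.
    apply/eqP; rewrite eqn_leq le /= leqNgt; apply/negP => lt.
    have : (\sum_i m (w i) < \sum_i u i)%N.
      rewrite (bigD1 i) //= [in X in (_ < X)%N](bigD1 i) //= -addSn leq_add //.
      by apply: leq_sum => a _.
    by rewrite sw ltnn.
  by apply: eq_bigr => i _; rewrite !mxE eqm leqnn subnn eqxx fact0 invr1.
rewrite negb_forall => /existsP [i]; rewrite -ltnNge => lt.
by rewrite (bigD1 i) //= [RHS](bigD1 i) //= !mxE leqNgt lt ltn_eqF // !mul0r.
Qed.

Lemma skew_det0 (m u : 'I_N -> nat) : (\sum_i u i < \sum_i m i)%N -> skew_det m u = 0.
Proof.
move=> su; rewrite /skew_det /determinant big1 // => w _.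
case: (boolP [forall i, m (w i) <= u i]%N) => [/forallP le|].
  have : (\sum_i m (w i) <= \sum_i u i)%N by apply: leq_sum.
  have -> : (\sum_i m (w i) = \sum_i m i)%N by rewrite [RHS](reindex_inj (@perm_inj _ w)).
  by rewrite leqNgt su.
rewrite negb_forall => /existsP [i]; rewrite -ltnNge => lt.
by rewrite (bigD1 i) //= !mxE leqNgt lt !mul0r mulr0.
Qed.

(** Restriction by one point and the determinant obey the same recursion in [j]; the case j = 0 is
    orthogonality. *)
Lemma sum_chi_restrict k j (m u : 'I_N -> nat) :
  (\sum_i m i = k + \sum_(i < N) stair i)%N -> (\sum_i u i = \sum_i m i + j)%N ->
  (\sum_(g : 'S_k) chi m g * chi u (shift_perm j g))%:~R = (k`! * j`!)%:R * skew_det m u.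
Proof.
move=> sm; elim: j u => [|j IH] u su /=.
  rewrite addn0 in su; rewrite muln1 skew_det_eq_size //.
  rewrite (eq_bigr (fun g => chi u g * chi m g)) => [|g _]; last by rewrite mulrC.
  rewrite chi_orthogonal ?su // rmorphMn /= -mulr_natl; congr (_ * _).
  by rewrite -det_map_mx; congr (\det _); apply/matrixP => a b; rewrite !mxE rmorph_nat.
have := skew_det_rec su => e.
rewrite factS mulnCA natrM mulrAC e.
under eq_bigr => g _ do rewrite chi_lift big_distrr /=.
rewrite exchange_big rmorph_sum mulr_suml /=; apply: eq_bigr => i ui.
rewrite IH; first by rewrite mulrC.
by apply: succn_inj; rewrite sum_decr // su addnS.
Qed.

End Restriction.

(** * Restriction of the sum of symmetrizers over all fillings *)

Section YoungSumLift.
Local Open Scope ring_scope.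
Variables (N L : nat).

Notation lift0 g := (lift_perm ord0 ord0 g).

Lemma lift0_inj n : injective (fun g : 'S_n => lift0 g).
Proof.
move=> g h e; apply/permP => x; apply: (@lift_inj _ ord0).
by have := congr1 (fun s : 'S_n.+1 => s (lift ord0 x)) e; rewrite !lift_perm_lift.
Qed.

Lemma lift0_onto n (t : 'S_n.+1) : t ord0 = ord0 -> exists t' : 'S_n, t = lift0 t'.
Proof.
move=> t0; pose f k := odflt k (unlift ord0 (t (lift ord0 k))).
have fE k : lift ord0 (f k) = t (lift ord0 k).
  rewrite /f; case: unliftP => [y ->//|]; rewrite -[in RHS]t0 => /perm_inj e.
  by have := neq_lift ord0 k; rewrite e eqxx.
have f_inj : injective f by move=> x y e; apply/(@lift_inj _ ord0)/(@perm_inj _ t); rewrite -!fE e.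
exists (perm f_inj); apply/permP => x; case: (unliftP ord0 x) => [y ->|->].
  by rewrite lift_perm_lift permE fE.
by rewrite lift_perm_id.
Qed.

Lemma relabel_cons n (J : finType) (c : J) (f : {ffun 'I_n -> J}) g :
  relabel (ffun_cons c f) (lift0 g) = ffun_cons c (relabel f g).
Proof.
apply/ffunP => x; rewrite ffunE; case: (unliftP ord0 x) => [y ->|->].
  by rewrite lift_perm_lift !ffun_consS ffunE.
by rewrite lift_perm_id !ffun_cons0.
Qed.

Lemma ffun_cons_inj n (J : Type) (c : J) : injective (@ffun_cons n J c).
Proof. by move=> f f' e; apply/ffunP => x; rewrite -(ffun_consS c) e ffun_consS. Qed.

(** A column permutation [t] that contributes on the left keeps the new point in its row as well as
    in its column; no other point occupies that cell, so [t] fixes the new point. *)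
Lemma young_cons n (J K : finType) (rho : {ffun 'I_n -> J}) (kap : {ffun 'I_n -> K}) r k g :
  (forall x, (rho x, kap x) != (r, k)) ->
  young (ffun_cons r rho) (ffun_cons k kap) (lift0 g) = young rho kap g.
Proof.
move=> new; rewrite /young.
have t0 (t : 'S_n.+1) : fixed_by (ffun_cons k kap) t &&
  (relabel (ffun_cons r rho) t == relabel (ffun_cons r rho) (lift0 g)) -> t ord0 = ord0.
  move=> /andP[/fixed_byP /(_ ord0) kt /eqP/ffunP/(_ ord0)].
  rewrite !ffunE lift_perm_id unlift_none; move: kt.
  rewrite !ffunE unlift_none; case: unliftP => // y _ ky ry.
  by case/eqP: (new y); rewrite ky ry.
rewrite (reindex_omap (fun t' : 'S_n => lift0 t') (fun t => [pick t' | lift0 t' == t])) /=; last first.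
  move=> t /t0 /lift0_onto [t' ->]; case: pickP => [t'' /eqP /lift0_inj ->//|/(_ t')].
  by rewrite eqxx.
apply: eq_big => [t|t _]; last by rewrite odd_lift_perm.
have -> : [pick t' | lift0 t' == lift0 t] == Some t.
  case: pickP => [t' /eqP/lift0_inj -> //|/(_ t)]; by rewrite eqxx.
by rewrite andbT fixed_by_cons !relabel_cons (inj_eq (@ffun_cons_inj _ _ _)).
Qed.

Variable lam : 'I_N -> nat.
Hypothesis lamL : forall i, (lam i <= L)%N.

(** For an injective filling, the new point may occupy any of the |lam| - n free cells, without
    effect on the coefficient; a repeated cell gives zero. *)
Lemma young_sum_lift n (g : 'S_n) :
  young_sum L lam (lift0 g) = young_sum L lam g *+ (\sum_i lam i - n)%N.
Proof.
rewrite /young_sum big_mkcond sum_ffun_cons [in RHS]big_mkcond -sumrMnl.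
apply: eq_bigr => T _.
have inE' c : in_diagram lam (ffun_cons c T) = (c \in diagram lam L) && in_diagram lam T.
  apply/forallP/andP => [h|[]].
    split; first by have := h ord0; rewrite ffun_cons0 inE.
    by apply/forallP => x; have := h (lift ord0 x); rewrite ffun_consS.
  rewrite inE => hc /forallP h x; case: (unliftP ord0 x) => [y ->|->].
    by rewrite ffun_consS.
  by rewrite ffun_cons0.
case: ifP => Tin; last first.
  by rewrite mul0rn big1 // => c _; rewrite inE' Tin andbF.
have rc c : row_of (ffun_cons c T) = ffun_cons c.1 (row_of T).
  by apply/ffunP => x; rewrite !ffunE; case: unliftP => [y _|_]; rewrite ?ffunE.
have cc c : col_of (ffun_cons c T) = ffun_cons c.2 (col_of T).
  by apply/ffunP => x; rewrite !ffunE; case: unliftP => [y _|_]; rewrite ?ffunE.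
case: (boolP (injectiveb T)) => [/injectiveP Tinj|nT]; last first.
  rewrite young_not_inj // mul0rn big1 // => c _; rewrite young_not_inj ?if_same //.
  move/injectivePn: nT => [y [z yz e]]; apply/injectivePn; exists (lift ord0 y), (lift ord0 z).
    by rewrite (inj_eq (@lift_inj _ _)).
  by rewrite !ffun_consS.
transitivity (\sum_(c in diagram lam L :\: [set T x | x : 'I_n]) young (row_of T) (col_of T) g).
  rewrite [RHS]big_mkcond; apply: eq_bigr => c _; rewrite inE' Tin andbT in_setD.
  case: (boolP (c \in _)) => cD; last by rewrite andbF.
  rewrite andbT; case: imsetP => [[x _ cx]|nx] /=.
    rewrite young_not_inj //; apply/injectivePn; exists ord0, (lift ord0 x) => //.
    by rewrite ffun_cons0 ffun_consS.
  rewrite rc cc young_cons // => x; rewrite !ffunE; apply/eqP => e; case: nx; exists x => //.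
  by rewrite [c]surjective_pairing -e -surjective_pairing.
rewrite sumr_const; congr (_ *+ _).
rewrite cardsD card_diagram //; congr subn.
rewrite -[RHS]card_ord -(card_imset _ Tinj); apply: eq_card => c.
rewrite in_setI; apply/andb_idl => /imsetP [x _ ->]; rewrite inE.
by have /forallP := Tin.
Qed.

Lemma young_sum_shift j k (g : 'S_k) :
  young_sum L lam (shift_perm j g) = young_sum L lam g *+ ((\sum_i lam i - k) ^_ j)%N.
Proof.
elim: j => [|j IH] /=; first by rewrite mulr1n.
by rewrite (@young_sum_lift (j + k)) IH -mulrnA ffactnSr -subnDA addnC.
Qed.

End YoungSumLift.

Section SkewRatio.
Local Open Scope ring_scope.
Variable N : nat.

Lemma chi_unit n (u : 'I_N -> nat) : (\sum_i u i = n + \sum_(i < N) stair i)%N ->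
  (chi u (1%g : 'S_n))%:~R = n`!%:R * skew_det (@stair N) u.
Proof.
elim: n u => [|n IH] u su.
  rewrite mul1r skew_det_eq_size // /chi.
  pose f0 : {ffun 'I_0 -> 'I_N} := ffun0 (card_ord 0).
  rewrite (big_pred1 f0) => [|f]; last first.
    have -> : f = f0 by apply/ffunP => -[].
    by rewrite /= eqxx; apply/fixed_byP => -[].
  rewrite -det_map_mx; congr (\det _); apply/matrixP => a b; rewrite !mxE rmorph_nat.
  congr (nat_of_bool _)%:R; rewrite eq_sym; congr (_ == _).
  by rewrite /content eq_card0 // => -[].
rewrite -(lift_perm1 ord0) chi_lift rmorph_sum /= factS natrM mulrAC.
rewrite skew_det_rec ?su 1?addnC // big_distrl /=; apply: eq_bigr => i ui.
rewrite IH; first by rewrite mulrC.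
by apply: succn_inj; rewrite sum_decr // su.
Qed.

Variables (lam nu : 'I_N -> nat).
Hypothesis lam_decr : forall i j : 'I_N, (i <= j)%N -> (lam j <= lam i)%N.
Let l (i : 'I_N) := (lam i + stair i)%N.
Let m (i : 'I_N) := (nu i + stair i)%N.

Lemma skew_det_neq0 : skew_det (@stair N) l != 0.
Proof.
have sl : (\sum_i l i = (\sum_i lam i) + \sum_(i < N) stair i)%N by rewrite -big_split.
have := chi_unit_neq0 lam_decr (erefl _).
rewrite -(intr_eq0 rat) (chi_unit sl) mulf_eq0 negb_or => /andP[] //.
Qed.

(** The pairing of [chi m] with the restriction of [chi l] to S_k is computed by [sum_chi_restrict]
    and, through [chi_ratio], by fillings; the (n - k)! arrangements of the remaining points cancel.
    When k exceeds |lam|, the determinant vanishes by size and no filling is injective. *)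
Lemma skew_ratio k L : (forall i, lam i <= L)%N -> k = (\sum_i nu i)%N ->
  skew_det m l / skew_det (@stair N) l =
  (\sum_(T : {ffun 'I_k -> 'I_N * 'I_L} | in_diagram lam T)
     \sum_g young (row_of T) (col_of T) g * chi m g)%:~R / k`!%:R.
Proof.
move=> lamL kE.
have sl : (\sum_i l i = (\sum_i lam i) + \sum_(i < N) stair i)%N by rewrite -big_split.
have sm : (\sum_i m i = k + \sum_(i < N) stair i)%N by rewrite kE -big_split.
set Y := \sum_(T | _) _.
have YE : Y = \sum_(g : 'S_k) chi m g * young_sum L lam g.
  rewrite /Y exchange_big /=; apply: eq_bigr => g _; rewrite /young_sum big_distrr /=.
  by apply: eq_bigr => T _; rewrite mulrC.
case: (leqP k (\sum_i lam i)) => kn; last first.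
  rewrite skew_det0 ?mul0r; last by rewrite sl sm ltn_add2r.
  have -> : Y = 0; last by rewrite mul0r.
  rewrite /Y big1 // => T Tin; rewrite big1 // => g _; rewrite young_not_inj ?mul0r //.
  apply/negP => /injectiveP Tinj.
  have : (#|[set T x | x : 'I_k]| <= #|diagram lam L|)%N.
    apply: subset_leq_card; apply/subsetP => c /imsetP [x _ ->]; rewrite inE.
    by have /forallP := Tin.
  by rewrite card_diagram // card_imset // card_ord leqNgt kn.
pose j := (\sum_i lam i - k)%N.
have nE : (j + k = \sum_i lam i)%N by rewrite /j subnK.
have key : (j + k)`!%:R * \sum_(g : 'S_k) chi m g * chi l (shift_perm j g) =
    chi l (1%g : 'S_(j + k)) * (Y *+ j`!).
  rewrite YE -sumrMnl !big_distrr /=; apply: eq_bigr => g _.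
  rewrite mulrCA -(chi_ratio lam_decr _ lamL nE) young_sum_shift // -/j ffactnn.
  by rewrite -!mulrnAr; ring.
have {key} := congr1 (fun z : int => z%:~R : rat) key.
rewrite rmorphM rmorph_nat [X in _ = X]rmorphM rmorphMn /= sum_chi_restrict //; last first.
  by rewrite sl sm -nE; lia.
rewrite chi_unit; last by rewrite sl nE.
have D0 := skew_det_neq0; have f0 i : i`!%:R != 0 :> rat by rewrite pnatr_eq0 -lt0n fact_gt0.
have ar (F : fieldType) (a b c d e y : F) : a != 0 -> b != 0 -> c != 0 -> e != 0 ->
    a * (b * c * d) = a * e * (y * c) -> d / e = y / b.
  move=> a0 b0 c0 e0 h; have {}h : b * c * d = e * (y * c) by apply: (mulfI a0); rewrite h -mulrA.
  apply/eqP; rewrite eqr_div // -(inj_eq (mulIf c0)); apply/eqP.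
  by transitivity (b * c * d); [ring | rewrite h; ring].
rewrite natrM -[Y%:~R *+ _]mulr_natr; exact: ar.
Qed.

End SkewRatio.

(** * Independence of the number of variables *)

Section Stability.
Local Open Scope ring_scope.

Definition shifted (nu : nat -> nat) N (i : 'I_N) : nat := (nu i + stair i)%N.

(** The last row of the slot matrix has to reach exponent 0: a word that uses the new letter
    contributes nothing, and for the others this row is the last unit vector. After its expansion,
    the staircase drops by one on both sides of the remaining equations. *)
Lemma chi_pad n N (nu : nat -> nat) (g : 'S_n) : nu N = 0%N ->
  chi (@shifted nu N.+1) g = chi (@shifted nu N) g.
Proof.
move=> nuN; rewrite /chi.
pose up (f : {ffun 'I_n -> 'I_N}) : {ffun 'I_n -> 'I_N.+1} := [ffun x => lift ord_max (f x)].
have up_inj : injective up.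
  by move=> f f' /ffunP e; apply/ffunP => x; move: (e x); rewrite !ffunE => /lift_inj.
have up_onto (f : {ffun 'I_n -> 'I_N.+1}) : content f ord_max = 0%N -> exists f', f = up f'.
  move=> /card0_eq f0.
  have /fin_all_exists [f' f'E] x : exists y, f x = lift ord_max y.
    by case: (unliftP ord_max (f x)) (f0 x) => [y -> _|e]; [exists y | rewrite inE e eqxx].
  by exists (finfun f'); apply/ffunP => x; rewrite !ffunE.
rewrite (bigID (fun f => content f ord_max == 0%N)) /= [X in _ + X]big1 ?addr0; last first.
  move=> f /andP[_ fmax]; rewrite (expand_det_row _ ord_max) big1 // => j _.
  rewrite mxE /shifted nuN /stair /= subnn addn_eq0 (negPf fmax) mul0r //.
rewrite (reindex_omap up (fun f => [pick f' | up f' == f])) /=; last first.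
  move=> f /andP[_ /eqP /up_onto [f' ->]]; case: pickP => [f'' /eqP /up_inj ->//|/(_ f')].
  by rewrite eqxx.
have up_max f : content (up f) ord_max = 0%N.
  by apply/eq_card0 => x; rewrite !inE ffunE eq_sym (negPf (neq_lift _ _)).
have up_lift f i : content (up f) (lift ord_max i) = content f i.
  by apply: eq_card => x; rewrite !inE ffunE (inj_eq (@lift_inj _ _)).
apply: eq_big => [f|f _].
  rewrite up_max eqxx /=; have -> : [pick f' | up f' == up f] == Some f.
    by case: pickP => [f'' /eqP /up_inj ->|/(_ f)]; rewrite eqxx.
  rewrite !andbT; apply/fixed_byP/fixed_byP => h x.
    by apply: (@lift_inj _ ord_max); move: (h x); rewrite !ffunE.
  by rewrite !ffunE h.
rewrite (expand_det_row _ ord_max) (bigD1 ord_max) //= big1 ?addr0 => [|j jmax]; last first.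
  have jN : (j < N)%N by rewrite ltn_neqAle -ltnS ltn_ord andbT; exact: jmax.
  rewrite mxE up_max /shifted nuN /stair /= subnn add0n addn0 subn_eq0 ltnNge.
  by rewrite jN mul0r.
rewrite mxE up_max /shifted nuN /stair /= subnn eqxx mul1r /cofactor addnn -signr_odd odd_double expr0 mul1r.
congr (\det _); apply/matrixP => i j; rewrite !mxE up_lift; congr (nat_of_bool _)%:R.
rewrite /shifted /stair !lift_max; have := ltn_ord i; have := ltn_ord j.
by move=> /= hj hi; apply/idP/idP => /eqP ?; apply/eqP; lia.
Qed.

Lemma chi_stable n N N' (nu : nat -> nat) (g : 'S_n) :
  (N <= N')%N -> (forall i, (N <= i)%N -> nu i = 0%N) ->
  chi (@shifted nu N') g = chi (@shifted nu N) g.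
Proof.
move=> NN' nu0; rewrite -(subnK NN'); elim: (N' - N)%N => [|d IH] //.
by rewrite addSn chi_pad // nu0 // leq_addl.
Qed.

End Stability.

(** * Counting fillings of multirectangular diagrams *)

Section Patterns.
Variables (X O : finType) (bl : X -> O).

(** A point added to an injective placement has to avoid the positions already taken in its own
    block; its label keeps it out of all other blocks. *)
Lemma card_inj_blocks q (a : {ffun 'I_q -> O}) :
  #|[pred h : {ffun 'I_q -> X} | injectiveb h && [forall x, bl (h x) == a x]]| =
  \prod_o (#|[pred x | bl x == o]| ^_ #|[pred i | a i == o]|).
Proof.
elim: q a => [|q IH] a.
  rewrite big1 => [|o _]; last by rewrite [X in _ ^_ X]eq_card0 // => -[].
  rewrite (eq_card (B := predT)) => [|h].
    by rewrite card_ffun card_ord expn0.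
  by rewrite !inE; apply/andP; split; [apply/injectiveP => -[] | apply/forallP => -[]].
pose a' : {ffun 'I_q -> O} := [ffun x => a (lift ord0 x)].
pose o0 := a ord0.
have ae o : #|[pred i | a i == o]| = (o0 == o) + #|[pred i | a' i == o]|.
  rewrite -!sum1_card [LHS]big_mkcond [X in (_ + X)%N]big_mkcond big_ord_recl /=; congr addn.
  by apply: eq_bigr => x _; rewrite ?inE ffunE.
rewrite (eq_bigr (fun o => (if o == o0 then #|[pred x | bl x == o]| - #|[pred i | a' i == o]| else 1) *
   (#|[pred x | bl x == o]| ^_ #|[pred i | a' i == o]|))); last first.
  move=> o _; rewrite ae [o0 == o]eq_sym; case: (o == o0); last by rewrite mul1n.
  by rewrite add1n ffactnSr mulnC.
rewrite big_split /= -big_mkcond big_pred1_eq -IH.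
rewrite -sum1_card big_mkcond sum_ffun_cons.
rewrite -[X in _ = _ * X]sum1_card [X in _ = _ * X]big_mkcond big_distrr /=.
apply: eq_bigr => h _; rewrite inE.
have eqc x : (ffun_cons x h \in [pred h : {ffun 'I_q.+1 -> X} | injectiveb h & [forall y, bl (h y) == a y]]) =
   [&& bl x == o0, x \notin codom h, injectiveb h & [forall x, bl (h x) == a' x]].
  rewrite inE; apply/andP/and4P => [[/injectiveP hi /forallP ha]|[bx xh /injectiveP hi /forallP ha]].
    split.
    - by have := ha ord0; rewrite ffun_cons0.
    - apply/negP => /codomP [y xy]; have := hi ord0 (lift ord0 y).
      by rewrite ffun_cons0 ffun_consS xy => /(_ erefl).
    - by apply/injectiveP => y z e; apply: (@lift_inj _ ord0); apply: hi; rewrite !ffun_consS.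
    - by apply/forallP => y; have := ha (lift ord0 y); rewrite ffun_consS ffunE.
  split.
    apply/injectiveP => y z; case: (unliftP ord0 y) => [y' ->|->]; case: (unliftP ord0 z) => [z' ->|->] //;
      rewrite ?ffun_consS ?ffun_cons0.
    - by move/hi => ->.
    - by move=> e; case/negP: xh; rewrite -e codom_f.
    - by move=> e; case/negP: xh; rewrite e codom_f.
  apply/forallP => y; case: (unliftP ord0 y) => [y' ->|->]; first by rewrite ffun_consS; have := ha y'; rewrite ffunE.
  by rewrite ffun_cons0.
under eq_bigr => x _ do rewrite eqc.
case: (boolP (injectiveb h)) => [hi|]; last by rewrite muln0 big1 // => x _; rewrite !andbF.
case: (boolP [forall x, _]) => [/forallP ha|]; last by rewrite muln0 big1 // => x _; rewrite !andbF.
rewrite muln1 -big_mkcond sum1_card /=.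
have -> : #|[pred i | a' i == o0]| = #|[set x in codom h | bl x == o0]|.
  rewrite -(card_imset _ (injectiveP _ hi)); apply: eq_card => x; rewrite !inE.
  apply/imsetP/andP => [[i]|[/codomP [i ->]]].
    by rewrite inE => /eqP <- ->; rewrite codom_f (ha i).
  by rewrite (eqP (ha i)) => e; exists i.
have -> : #|[pred x | bl x == o0]| = #|[set x | bl x == o0]| by apply: eq_card => x; rewrite !inE.
rewrite -[X in _ - X](_ : #|[set x | bl x == o0] :&: [set x in codom h]| = _); last first.
  by apply: eq_card => x; rewrite !inE andbC.
rewrite -cardsD; apply: eq_card => x; rewrite [LHS]unfold_in !inE.
by case: (bl x == o0); case: (x \in codom h).
Qed.

End Patterns.

Section Pattern.
Variable k : nat.

(** The partition of the points into fibres is encoded by a map to chosen representatives, so that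
    patterns of row maps and of column maps live in one finite type. *)
Definition pattern (X : finType) (rho : {ffun 'I_k -> X}) : {ffun 'I_k -> 'I_k} :=
  [ffun x => odflt x [pick y | rho y == rho x]].

Lemma patternP (X : finType) (rho : {ffun 'I_k -> X}) x : rho (pattern rho x) = rho x.
Proof. by rewrite ffunE; case: pickP => [y /eqP|]. Qed.

Lemma pattern_eq (X : finType) (rho : {ffun 'I_k -> X}) x y :
  (pattern rho x == pattern rho y) = (rho x == rho y).
Proof.
apply/eqP/eqP => [e|e]; first by rewrite -patternP e patternP.
rewrite !ffunE e; case: pickP => [//|/(_ y)]; by rewrite eqxx.
Qed.

Lemma eq_pattern (X Y : finType) (rho : {ffun 'I_k -> X}) (rho' : {ffun 'I_k -> Y}) :
  (forall x y, (rho x == rho y) = (rho' x == rho' y)) -> pattern rho = pattern rho'.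
Proof. by move=> e; apply/ffunP => x; rewrite !ffunE; congr odflt; apply: eq_pick => y /=. Qed.

Lemma pattern_idem (X : finType) (rho : {ffun 'I_k -> X}) : pattern (pattern rho) = pattern rho.
Proof. by apply: eq_pattern => x y; rewrite pattern_eq. Qed.

Lemma pattern_fixed (pi : {ffun 'I_k -> 'I_k}) x : pattern pi = pi -> pi (pi x) = pi x.
Proof. by move=> {2}<-; rewrite patternP. Qed.

Variables (X O : finType) (bl : X -> O).

Definition reps (pi : {ffun 'I_k -> 'I_k}) : pred 'I_k := [pred x | pi x == x].

Lemma repsE pi x : (x \in reps pi) = (pi x == x).
Proof. by []. Qed.

Definition valid_pattern (pi : {ffun 'I_k -> 'I_k}) (a : {ffun 'I_k -> O}) :=
  (pattern pi == pi) && [forall x, a (pi x) == a x].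

(** A map with pattern [pi] amounts to an injective map on the representatives, to which
    [card_inj_blocks] applies. *)
Lemma card_pattern pi a :
  #|[pred rho : {ffun 'I_k -> X} | (pattern rho == pi) && ([ffun x => bl (rho x)] == a)]| =
  if valid_pattern pi a then
    \prod_o (#|[pred x | bl x == o]| ^_ #|[pred x | (x \in reps pi) && (a x == o)]|) else 0.
Proof.
case: ifP => [/andP[/eqP ppi /forallP api]|nv]; last first.
  apply: eq_card0 => rho; rewrite inE; apply/negP => /andP[/eqP rpi /eqP rbl].
  move/negP: nv; apply; rewrite /valid_pattern -rpi pattern_idem eqxx; apply/forallP => x.
  by rewrite -rbl [X in X == _]ffunE [X in _ == X]ffunE patternP.
pose q := #|reps pi|.
pose e (i : 'I_q) : 'I_k := enum_val i.
have e_reps i : pi (e i) = e i by have := enum_valP i; rewrite repsE => /eqP.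
have e_inj : injective e by exact: enum_val_inj.
have rk x : exists i, e i = pi x.
  have pr : pi x \in reps pi by rewrite repsE pattern_fixed.
  by exists (enum_rank_in pr (pi x)); rewrite /e enum_rankK_in.
have /fin_all_exists [rank rankE] := rk.
pose a' : {ffun 'I_q -> O} := [ffun i => a (e i)].
transitivity #|[pred h : {ffun 'I_q -> X} | injectiveb h && [forall x, bl (h x) == a' x]]|; last first.
  rewrite card_inj_blocks; apply: eq_bigr => o _; congr (_ ^_ _).
  rewrite -(card_imset _ e_inj); apply: eq_card => x; rewrite [RHS]inE repsE.
  apply/imsetP/andP => [[i]|[/eqP px ax]].
    by rewrite inE ffunE => ai ->; rewrite e_reps.
  have [i ei] := rk x; exists i; last by rewrite ei px.
  by rewrite inE ffunE ei px.
pose down (rho : {ffun 'I_k -> X}) : {ffun 'I_q -> X} := [ffun i => rho (e i)].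
pose up (h : {ffun 'I_q -> X}) : {ffun 'I_k -> X} := [ffun x => h (rank x)].
rewrite -(card_in_imset (f := down)); last first.
  move=> rho rho'; rewrite !inE => /andP[/eqP rp _] /andP[/eqP rp' _] /ffunP d.
  apply/ffunP => x; rewrite -(patternP rho) -(patternP rho') rp rp' -rankE.
  by have := d (rank x); rewrite !ffunE.
apply: eq_card => h; rewrite [RHS]inE; apply/imsetP/andP => [[rho]|[/injectiveP hi /forallP hb]].
  rewrite inE => /andP[/eqP rp /eqP rb] ->; split.
    apply/injectiveP => i j; rewrite !ffunE => /eqP; rewrite -pattern_eq rp !e_reps => /eqP.
    exact: e_inj.
  by apply/forallP => i; rewrite !ffunE -rb ffunE.
have ranke i : rank (e i) = i by apply: e_inj; rewrite rankE e_reps.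
exists (up h); last by apply/ffunP => i; rewrite !ffunE ranke.
rewrite inE; apply/andP; split.
  rewrite -[X in _ == X]ppi; apply/eqP/eq_pattern => x y; rewrite !ffunE (inj_eq hi).
  by rewrite -(inj_eq e_inj) !rankE.
apply/eqP/ffunP => x; rewrite !ffunE (eqP (hb _)) ffunE rankE; exact/eqP.
Qed.

End Pattern.

Section Blocks.
Variable d : nat.
Implicit Types (p r : 'I_d -> nat) (s t : 'I_d).

Definition row_blocks p : seq 'I_d := flatten [seq nseq (p s) s | s <- enum 'I_d].
(** Reversed, because the leftmost columns cross every block of rows and belong to the last index. A
    cell in row block [s] and column block [t] is in the diagram exactly when s <= t. *)
Definition col_blocks r : seq 'I_d := flatten [seq nseq (r s) s | s <- rev (enum 'I_d)].

Definition tail_sum r s : nat := \sum_(t < d | s <= t) r t.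

Lemma multirect_blocks p r : multirect p r = [seq tail_sum r s | s <- row_blocks p].
Proof.
rewrite /multirect /row_blocks map_flatten -map_comp; congr flatten.
by apply: eq_map => s /=; rewrite map_nseq.
Qed.

Lemma pairwise_flatten_nseq (e : rel 'I_d) (m : 'I_d -> nat) (l : seq 'I_d) :
  reflexive e -> pairwise e l -> pairwise e (flatten [seq nseq (m s) s | s <- l]).
Proof.
move=> er; elim: l => //= s l IH /andP[sl /IH pl]; rewrite pairwise_cat pl andbT; apply/andP; split.
  apply/allrelP => x y /nseqP[-> _] /flattenP [z /mapP [t tl ->] /nseqP [-> _]].
  by move/allP: sl => /(_ _ tl).
by elim: (m s) => //= q ->; rewrite andbT; apply/allP => y /nseqP[-> _].
Qed.

Lemma pairwise_enum : pairwise (fun s t => s <= t) (enum 'I_d).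
Proof.
have := iota_sorted 0 d; rewrite -val_enum_ord sorted_map (sorted_pairwise) //.
by move=> y x z; exact: leq_trans.
Qed.

Lemma pairwise_row_blocks p : pairwise (fun s t => s <= t) (row_blocks p).
Proof. by apply: pairwise_flatten_nseq pairwise_enum => s. Qed.

Lemma pairwise_col_blocks r : pairwise (fun s t => t <= s) (col_blocks r).
Proof.
apply: pairwise_flatten_nseq => [s //|].
rewrite -(@sorted_pairwise _ (fun s t => t <= s)); last by move=> y x z h1 h2; exact: leq_trans h2 h1.
rewrite rev_sorted sorted_pairwise; last by move=> y x z; exact: leq_trans.
exact: pairwise_enum.
Qed.

Lemma count_blocks (P : pred 'I_d) (m : 'I_d -> nat) (l : seq 'I_d) :
  count P (flatten [seq nseq (m s) s | s <- l]) = \sum_(s <- l | P s) m s.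
Proof.
elim: l => [|s l IH] /=; first by rewrite big_nil.
by rewrite count_cat count_nseq IH big_cons; case: (P s); rewrite ?mul1n ?mul0n.
Qed.

Lemma count_row_blocks p (P : pred 'I_d) : count P (row_blocks p) = \sum_(s | P s) p s.
Proof. by rewrite count_blocks big_enum_cond. Qed.

Lemma count_col_blocks r (P : pred 'I_d) : count P (col_blocks r) = \sum_(s | P s) r s.
Proof.
rewrite count_blocks; transitivity (\sum_(s <- enum 'I_d | P s) r s); last by rewrite big_enum_cond.
by apply: perm_big; rewrite perm_rev.
Qed.

Lemma size_col_blocks r : size (col_blocks r) = \sum_s r s.
Proof. by rewrite -count_predT count_col_blocks. Qed.

(** The list decreases weakly, so the columns of blocks [t] with s <= t form a prefix, of length
    [tail_sum r s]. *)
Lemma onth_col_blocks r s j : (j < tail_sum r s) = (if onth (col_blocks r) j is Some t then s <= t else false).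
Proof.
have -> : tail_sum r s = count (fun t : 'I_d => s <= t) (col_blocks r) by rewrite count_col_blocks.
elim: (col_blocks r) (pairwise_col_blocks r) j => [_ j|t l IH /=]; first by rewrite onth0n.
move=> /andP[tl /IH {}IH] j.
case: (leqP s t) => st; first by case: j => [|j]; rewrite ?add1n //= ltnS IH.
have c0 : count (fun t : 'I_d => s <= t) l = 0.
  apply/eqP; rewrite -leqn0 leqNgt -has_count; apply/hasPn => t' /(allP tl) /= t't.
  by rewrite -ltnNge (leq_ltn_trans t't).
case: j => [|j] /=; first by rewrite c0 [RHS]leqNgt st.
by rewrite c0 add0n -IH c0.
Qed.

Lemma card_onth (T : eqType) (l : seq T) x N : size l <= N ->
  #|[pred i : 'I_N | onth l i == Some x]| = count_mem x l.
Proof.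
elim: l N => [|y l IH] N lN; first by apply: eq_card0 => i; rewrite inE onth0n.
case: N lN => // N lN; rewrite -sum1_card big_mkcond.
rewrite big_ord_recl /= inE /= -[Some y == Some x]/(y == x); congr addn.
by rewrite -(IH N) // -sum1_card [RHS]big_mkcond.
Qed.

Lemma multirect_cell p r i j : (j < nth 0 (multirect p r) i) =
  (if onth (row_blocks p) i is Some s then
     if onth (col_blocks r) j is Some t then s <= t else false
   else false).
Proof.
rewrite multirect_blocks; elim: (row_blocks p) i => [|s l IH] [|i] //=.
by rewrite onth_col_blocks.
Qed.

Lemma multirect_decr p r i i' : i <= i' -> nth 0 (multirect p r) i' <= nth 0 (multirect p r) i.
Proof.
rewrite multirect_blocks; have := pairwise_row_blocks p.
have tail_le s t : s <= t -> tail_sum r t <= tail_sum r s.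
  move=> st; rewrite /tail_sum big_mkcond [X in _ <= X]big_mkcond; apply: leq_sum => q _.
  by case: (leqP t q) => // tq; rewrite (leq_trans st tq).
elim: (row_blocks p) i i' => [|s l IH] [|i] [|i'] //= /andP[sl pl]; last by rewrite ltnS; apply: IH.
move=> _; case: (ltnP i' (size l)) => il; last by rewrite nth_default ?size_map.
by rewrite (nth_map s) //; apply/tail_le/(allP sl)/mem_nth.
Qed.

Lemma multirect_le p r i : nth 0 (multirect p r) i <= \sum_s r s.
Proof.
rewrite multirect_blocks; case: (ltnP i (size (row_blocks p))) => il.
  case E: (row_blocks p) il => [//|s l] il; rewrite -E (nth_map s) ?E //.
  by rewrite [leqRHS](bigID (fun t => nth s (s :: l) i <= t)) /= leq_addr.
by rewrite nth_default ?size_map.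
Qed.

End Blocks.

(** * Expansion in falling factorials *)

Section NonnegRatio.
Local Open Scope ring_scope.

Lemma young_pattern n (J K : finType) (rho : {ffun 'I_n -> J}) (kap : {ffun 'I_n -> K}) g :
  young rho kap g = young (pattern rho) (pattern kap) g.
Proof.
apply: eq_bigl => t; congr andb.
  by apply/fixed_byP/fixed_byP => h x; [apply/eqP; rewrite pattern_eq h | apply/eqP; rewrite -pattern_eq h].
apply/eqP/eqP => /ffunP h; apply/ffunP => x; move: (h x).
  by rewrite ![relabel _ _ _]ffunE => e; apply/eqP; rewrite pattern_eq e.
by rewrite ![relabel _ _ _]ffunE => e; apply/eqP; rewrite -pattern_eq e.
Qed.

Lemma prod_option (R : comPzRingType) (O : finType) (F : option O -> R) :
  \prod_o F o = F None * \prod_o F (Some o).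
Proof.
rewrite (bigD1 None) //=; congr (_ * _).
rewrite (reindex_omap (@Some O) id) => [|[o|]] //=.
by apply: eq_bigl => o; rewrite eqxx.
Qed.

Variables (d k : nat).
Notation labels := {ffun 'I_k -> option 'I_d}.
Notation index := ((labels * {ffun 'I_k -> 'I_k}) * (labels * {ffun 'I_k -> 'I_k}))%type.

(** The label [None] marks a padding row beyond the diagram and is compatible with nothing. *)
Definition compatible (a b : labels) : bool :=
  [forall x, if a x is Some s then if b x is Some t then (s <= t)%N else false else false].

Definition exponent (q : labels * {ffun 'I_k -> 'I_k}) (s : 'I_d) : nat :=
  #|[pred x | (x \in reps q.2) && (q.1 x == Some s)]|.

Definition admissible (q : index) : bool :=
  [&& compatible q.1.1 q.2.1, valid_pattern q.1.2 q.1.1 & valid_pattern q.2.2 q.2.1].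

(** Staying in the diagram depends only on the blocks. For fixed labels and patterns, row maps and
    column maps are therefore counted independently, giving the factors in [p] and in [r]. *)
Lemma sum_diagram_patterns (p r : 'I_d -> nat) N (c : {ffun 'I_k -> 'I_k} -> {ffun 'I_k -> 'I_k} -> rat) :
  (size (multirect p r) <= N)%N ->
  \sum_(T : {ffun 'I_k -> 'I_N * 'I_(\sum_s r s)%N} |
      in_diagram (fun i : 'I_N => nth 0%N (multirect p r) i) T)
    c (pattern (row_of T)) (pattern (col_of T)) =
  \sum_(q | admissible q) c q.1.2 q.2.2 * ff_monomial (exponent q.1) (exponent q.2) p r.
Proof.
move=> sN; set L := (\sum_s r s)%N.
have sR : (size (row_blocks p) <= N)%N by rewrite -(size_map (tail_sum r)) -multirect_blocks.
pose blX (i : 'I_N) := onth (row_blocks p) i.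
pose blY (j : 'I_L) := onth (col_blocks r) j.
have cX s : #|[pred i | blX i == Some s]| = p s.
  by rewrite card_onth // count_row_blocks big_pred1_eq.
have cY s : #|[pred j | blY j == Some s]| = r s.
  by rewrite card_onth ?size_col_blocks // count_col_blocks big_pred1_eq.
pose lab (I : finType) (bl : I -> option 'I_d) (f : {ffun 'I_k -> I}) : labels * {ffun 'I_k -> 'I_k} :=
  ([ffun x => bl (f x)], pattern f).
transitivity (\sum_(rho : {ffun 'I_k -> 'I_N}) \sum_(kap : {ffun 'I_k -> 'I_L})
   if compatible (lab _ blX rho).1 (lab _ blY kap).1 then c (pattern rho) (pattern kap) else 0).
  rewrite pair_big big_mkcond /=.
  rewrite (reindex (fun q : {ffun 'I_k -> 'I_N} * {ffun 'I_k -> 'I_L} => [ffun x => (q.1 x, q.2 x)])) /=; last first.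
    exists (fun T => (row_of T, col_of T)) => [[f g] _|T _].
      by congr (_, _); apply/ffunP => x; rewrite !ffunE.
    by apply/ffunP => x; rewrite !ffunE -surjective_pairing.
  apply: eq_bigr => -[f g] _ /=.
  have -> : row_of [ffun x => (f x, g x)] = f by apply/ffunP => x; rewrite !ffunE.
  have -> : col_of [ffun x => (f x, g x)] = g by apply/ffunP => x; rewrite !ffunE.
  congr (if _ then _ else _); apply: eq_forallb => x; rewrite !ffunE /=.
  by rewrite multirect_cell.
transitivity (\sum_(q1 : labels * {ffun 'I_k -> 'I_k}) \sum_(q2 : labels * {ffun 'I_k -> 'I_k})
   (if compatible q1.1 q2.1 then c q1.2 q2.2 else 0) *
   (#|[pred f | lab _ blX f == q1]|%:R * #|[pred f | lab _ blY f == q2]|%:R)).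
  rewrite (partition_big (lab _ blX) xpredT) //=; apply: eq_bigr => q1 _.
  rewrite exchange_big /= (partition_big (lab _ blY) xpredT) //=; apply: eq_bigr => q2 _.
  rewrite (eq_bigr (fun=> \sum_(f | lab _ blX f == q1) if compatible q1.1 q2.1 then c q1.2 q2.2 else 0)).
    by rewrite !sumr_const -mulrnA -natrM mulr_natr.
  by move=> kap /eqP <-; apply: eq_bigr => rho /eqP <-.
rewrite pair_big /= [RHS]big_mkcond; apply: eq_bigr => -[[a pi] [b sg]] _ /=.
have cardlab (I : finType) (bl : I -> option 'I_d) q :
    #|[pred f | lab _ bl f == q]| = (if valid_pattern q.2 q.1 then
    \prod_o (#|[pred x | bl x == o]| ^_ #|[pred x | (x \in reps q.2) && (q.1 x == o)]|) else 0)%N.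
  rewrite -card_pattern; apply: eq_card => f; rewrite !inE; case: q => q1 q2 /=.
  by rewrite /lab xpair_eqE andbC.
rewrite !cardlab /admissible /=; case: ifP => [/forallP comp|]; last by rewrite mul0r.
case: ifP => _ /=; last by rewrite mul0r mulr0.
case: ifP => _ /=; last by rewrite !mulr0.
(* Padding rows enter only through a falling factorial of order zero, which is why [N] disappears
   from the result. *)
have none (f : labels) (ph : {ffun 'I_k -> 'I_k}) : (forall x, f x != None) ->
    #|[pred x | (x \in reps ph) && (f x == None)]| = 0%N.
  by move=> fN; apply: eq_card0 => x; rewrite inE (negPf (fN x)) andbF.
rewrite !natr_prod !prod_option !none; last 2 first.
- by move=> x; have := comp x; case: (a x) => // s; case: (b x).
- by move=> x; have := comp x; case: (a x).
rewrite !ffactn0 !mul1r; congr (_ * (_ * _)); apply: eq_bigr => s _.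
  by rewrite cX.
by rewrite cY.
Qed.

End NonnegRatio.

Section NonnegRatioTheorem.
Local Open Scope ring_scope.

(** Serves both functions: [k0], the surplus of variables over rows, is the length of mu for one and
    its size for the other. The coefficients [c] are computed in [N0] variables and are thus the
    same for all [p] and [r]. *)
Lemma nonneg_skew_ratio d (nu : nat -> nat) N0 k0 :
  (forall i j, (i <= j)%N -> (nu j <= nu i)%N) -> (forall i, (N0 <= i)%N -> nu i = 0%N) ->
  (N0 <= k0)%N ->
  @nonneg_ff_polynomial d (fun p r => let N := (size (multirect p r) + k0)%N in
    skew_det (@shifted nu N) (@shifted (nth 0%N (multirect p r)) N) /
    skew_det (@stair N) (@shifted (nth 0%N (multirect p r)) N)).
Proof.
move=> nu_decr nu0 N0k0; pose k := (\sum_(i < N0) nu i)%N.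
pose c (pi sg : {ffun 'I_k -> 'I_k}) : rat :=
  (\sum_(g : 'S_k) young pi sg g * chi (@shifted nu N0) g)%:~R / k`!%:R.
have c_ge0 pi sg : 0 <= c pi sg.
  rewrite divr_ge0 ?ler0n // ler0z.
  by apply: (young_chi_ge0 (lam := fun i : 'I_N0 => nu i)) => // i j; exact: nu_decr.
exists [seq (exponent q.1, exponent q.2, c q.1.2 q.2.2) | q <- enum (@admissible d k)].
split; first by rewrite all_map; apply/allP => q _ /=.
move=> p r; set lam := multirect p r; set N := (size lam + k0)%N => /=.
have kN : k = (\sum_(i < N) nu i)%N.
  have N0N : (N0 <= N)%N by rewrite (leq_trans N0k0) // leq_addl.
  rewrite /k (big_ord_widen N nu N0N) big_mkcond; apply: eq_bigr => i _.
  by case: ltnP => // /nu0.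
rewrite (skew_ratio (lam := fun i : 'I_N => nth 0%N lam i) (nu := fun i : 'I_N => nu i)
  (L := (\sum_s r s)%N) _ _ kN); last 2 first.
- by move=> i j; exact: multirect_decr.
- by move=> i; exact: multirect_le.
rewrite big_map big_enum /= -(sum_diagram_patterns (N := N)) ?leq_addr //.
rewrite rmorph_sum mulr_suml; apply: eq_bigr => T _; congr (_%:~R / _).
apply: eq_bigr => g _; rewrite -young_pattern; congr (_ * _).
by apply: chi_stable => //; rewrite (leq_trans N0k0) // leq_addl.
Qed.

End NonnegRatioTheorem.

(** * Kostka numbers *)

Section Grid.
Variables N L : nat.
Notation grid := ('I_N * 'I_L)%type.

(* Semi-standard tableaux of shape [lam] and type [tau], drawn on a rectangle:
   the cells outside [lam] carry the extra entry [t]. *)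
Definition grid_ssyt t (lam tau : nat -> nat) (g : {ffun grid -> 'I_t.+1}) : bool :=
  [&& [forall c : grid, (g c < t) == (c.2 < lam c.1)],
      [forall c : grid, forall c' : grid,
         (c'.1 == c.1 :> nat) && (c'.2 == c.2.+1 :> nat) ==> (g c <= g c')],
      [forall c : grid, forall c' : grid,
         (c'.1 == c.1.+1 :> nat) && (c'.2 == c.2 :> nat) ==> (g c' < t) ==> (g c < g c')] &
      [forall v : 'I_t, #|[pred c : grid | g c == v :> nat]| == tau v]].

Lemma grid_ssytP t (lam tau : nat -> nat) (g : {ffun grid -> 'I_t.+1}) :
  reflect [/\ forall c : grid, (g c < t) = (c.2 < lam c.1),
     forall c c' : grid, c'.1 = c.1 :> nat -> c'.2 = c.2.+1 :> nat -> g c <= g c',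
     forall c c' : grid, c'.1 = c.1.+1 :> nat -> c'.2 = c.2 :> nat -> g c' < t -> g c < g c' &
     forall v, v < t -> #|[pred c : grid | g c == v :> nat]| = tau v]
   (grid_ssyt lam tau g).
Proof.
apply: (iffP and4P) => [[/forallP h1 /forallP h2 /forallP h3 /forallP h4]|[h1 h2 h3 h4]]; split.
- by move=> c; exact: (eqP (h1 c)).
- by move=> c c' e1 e2; have := h2 c => /forallP /(_ c'); rewrite e1 e2 !eqxx /=.
- by move=> c c' e1 e2; have := h3 c => /forallP /(_ c'); rewrite e1 e2 !eqxx /= => /implyP.
- by move=> v vt; exact: (eqP (h4 (Ordinal vt))).
- by apply/forallP => c; rewrite h1.
- by apply/forallP => c; apply/forallP => c'; apply/implyP => /andP[/eqP e1 /eqP e2]; apply: h2.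
- apply/forallP => c; apply/forallP => c'; apply/implyP => /andP[/eqP e1 /eqP e2].
  by apply/implyP; apply: h3.
- by apply/forallP => v; rewrite h4.
Qed.

Definition grid_kostka t (lam tau : nat -> nat) : nat := #|[pred g : {ffun grid -> 'I_t.+1} | grid_ssyt lam tau g]|.

Definition decr_row (lam : nat -> nat) i a := lam a - (a == i).

Variables (t : nat) (lam tau : nat -> nat).
Hypothesis lam_decr : forall i j, i <= j -> lam j <= lam i.
Hypothesis lam0 : forall i, N <= i -> lam i = 0.
Hypothesis lamL : forall i, lam i <= L.
Hypothesis tau_t : tau t = 1.

(** Inside the shape, a right neighbour would carry a second [t], and a lower neighbour an entry
    above [t]. *)
Lemma grid_max_corner (g : {ffun grid -> 'I_t.+2}) (c : grid) :
  grid_ssyt lam tau g -> g c = t :> nat -> lam c.1 = c.2.+1 /\ lam c.1.+1 < lam c.1.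
Proof.
move=> /grid_ssytP [h1 h2 h3 h4] gc.
have uniq c' : g c' = t :> nat -> c' = c.
  move=> gc'; apply/eqP; rewrite eq_sym; apply/negPn/negP => cc'.
  have : #|[set c; c']| <= #|[pred c : grid | g c == t :> nat]|.
    apply: subset_leq_card; apply/subsetP => x; rewrite !inE => /orP[/eqP ->|/eqP ->]; exact/eqP.
  by rewrite h4 // tau_t cards2 cc'.
have cl : c.2 < lam c.1 by rewrite -h1 gc.
have e : lam c.1 = c.2.+1.
  apply/eqP; rewrite eqn_leq cl andbT leqNgt; apply/negP => lt.
  have cL : c.2.+1 < L by rewrite (leq_trans lt).
  have lt' := h1 (c.1, Ordinal cL); rewrite /= lt ltnS in lt'.
  have := h2 c (c.1, Ordinal cL) erefl erefl; rewrite gc => ge.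
  have /uniq /(congr1 (fun c : grid => c.2 : nat)) /= : g (c.1, Ordinal cL) = t :> nat.
    by apply/eqP; rewrite eqn_leq ge lt'.
  lia.
split=> //; rewrite e ltnS leqNgt; apply/negP => lt.
have cN : c.1.+1 < N by rewrite ltnNge; apply/negP => /lam0 l0; rewrite l0 in lt.
have lt' := h1 (Ordinal cN, c.2); rewrite /= lt in lt'.
have := h3 c (Ordinal cN, c.2) erefl erefl lt'; rewrite gc => gt.
by rewrite ltnS in lt'; have := leq_trans gt lt'; rewrite ltnn.
Qed.

(** Truncation at [t] merges the largest entry with the marker of the outside cells. Both tableaux
    live on the same rectangle, so no cell has to be renumbered. *)
Lemma card_grid_corner (c0 : grid) : lam c0.1 = c0.2.+1 -> lam c0.1.+1 < lam c0.1 ->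
  #|[pred g : {ffun grid -> 'I_t.+2} | grid_ssyt lam tau g && (g c0 == t :> nat)]| =
  grid_kostka t (decr_row lam c0.1) tau.
Proof.
move=> e0 corner.
pose down (g : {ffun grid -> 'I_t.+2}) : {ffun grid -> 'I_t.+1} := [ffun c => inord (minn (g c) t)].
pose up (g : {ffun grid -> 'I_t.+1}) : {ffun grid -> 'I_t.+2} :=
  [ffun c => inord (if c == c0 then t else if g c < t then (g c : nat) else t.+1)].
have downE g (c : grid) : down g c = minn (g c) t :> nat by rewrite ffunE inordK // ltnS geq_minr.
have upE g (c : grid) : up g c = (if c == c0 then t else if g c < t then (g c : nat) else t.+1) :> nat.
  rewrite ffunE inordK //; case: ifP => // _; by case: ifP => //; lia.
have in_decr (c : grid) : (c.2 < decr_row lam c0.1 c.1) = (c != c0) && (c.2 < lam c.1).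
  rewrite /decr_row; case: (altP (c =P c0)) => [->|ne] /=; first by rewrite eqxx e0; lia.
  case: (altP (c.1 =P c0.1 :> nat)) => [e1|_]; last by rewrite subn0.
  have e2 : c.2 <> c0.2 :> nat.
    move=> e2; move/eqP: ne; apply.
    by rewrite [c]surjective_pairing [c0]surjective_pairing; congr (_, _); exact/val_inj.
  by rewrite e1 e0 subn1 /=; apply/idP/idP; lia.
have uniq (g : {ffun grid -> 'I_t.+2}) (c : grid) : grid_ssyt lam tau g -> g c0 = t :> nat -> g c = t :> nat -> c = c0.
  move=> /grid_ssytP [_ _ _ h4] g0 gc; apply/eqP/negPn/negP => cc0.
  have : #|[set c; c0]| <= #|[pred c : grid | g c == t :> nat]|.
    apply: subset_leq_card; apply/subsetP => x; rewrite !inE => /orP[/eqP ->|/eqP ->]; exact/eqP.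
  by rewrite h4 // tau_t cards2 cc0.
have g_le (g : {ffun grid -> 'I_t.+2}) (c : grid) : g c <= t.+1 by rewrite -ltnS.
have down_ssyt (g : {ffun grid -> 'I_t.+2}) : grid_ssyt lam tau g -> g c0 = t :> nat ->
    grid_ssyt (decr_row lam c0.1) tau (down g).
  move=> gS g0; have /grid_ssytP [h1 h2 h3 h4] := gS; apply/grid_ssytP; split.
  - move=> c; rewrite downE in_decr -h1; case: (altP (c =P c0)) => [->|ne]; first by rewrite g0; lia.
    have nt : g c <> t :> nat by move=> gt; case/eqP: ne; apply: uniq gS g0 gt.
    by apply/idP/idP; lia.
  - by move=> c c' e1 e2; rewrite !downE; have := h2 c c' e1 e2; lia.
  - by move=> c c' e1 e2; rewrite !downE => lt; have := h3 c c' e1 e2; lia.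
  move=> v vt; rewrite -h4; last exact: ltnW.
  by apply: eq_card => c; rewrite !inE downE; apply/eqP/eqP; lia.
have up_down (g : {ffun grid -> 'I_t.+2}) : grid_ssyt lam tau g -> g c0 = t :> nat -> up (down g) = g.
  move=> gS g0; apply/ffunP => c; apply/ord_inj; rewrite upE downE.
  case: eqP => [->//|ne]; have := g_le g c.
  have nt : g c <> t :> nat by move=> gt; apply: ne; apply: uniq gS g0 gt.
  move: (nat_of_ord (g c)) nt => v nt; rewrite /minn; case: ifP; case: ifP; lia.
have down_up (g : {ffun grid -> 'I_t.+1}) : grid_ssyt (decr_row lam c0.1) tau g -> down (up g) = g.
  move=> /grid_ssytP [h1 _ _ _]; apply/ffunP => c; apply/ord_inj; rewrite downE upE.
  have := ltn_ord (g c); have := h1 c; rewrite in_decr; case: eqP => [->|_] /=; first by lia.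
  by move=> _; case: ifP; lia.
have up_ssyt (g : {ffun grid -> 'I_t.+1}) : grid_ssyt (decr_row lam c0.1) tau g -> grid_ssyt lam tau (up g).
  move=> gS; have /grid_ssytP [h1 h2 h3 h4] := gS.
  have h1' (c : grid) : c <> c0 -> (g c < t) = (c.2 < lam c.1).
    by move=> /eqP ne; rewrite h1 in_decr ne.
  have g0 : g c0 = t :> nat.
    have := h1 c0; rewrite in_decr eqxx /=; have := ltn_ord (g c0); lia.
  apply/grid_ssytP; split.
  - move=> c; rewrite upE; case: eqP => [->|ne]; first by rewrite e0 !ltnS !leqnn.
    by rewrite -h1' //; case: ifP; lia.
  - move=> c c' e1 e2; rewrite !upE; case: eqP => [ec|ne].
      rewrite ec in e1 e2; case: eqP => [_ //|ne']; rewrite h1' // e1 e2 e0 ltnn; lia.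
    case: eqP => [ec'|ne'].
      by rewrite h1' // -e1 ec' e0; rewrite ec' in e2; rewrite e2 ltnS leqnSn; have := h1' c ne; rewrite -e1 ec' e0 e2; lia.
    by have := h2 c c' e1 e2; case: ifP; case: ifP; lia.
  - move=> c c' e1 e2; rewrite !upE; case: (c =P c0) => [ec|ne].
      rewrite ec in e1 e2; case: (c' =P c0) => [ec'|ne']; first by rewrite ec' in e1; lia.
      by rewrite h1' // e1 e2; move: corner; rewrite e0; case: ifP; lia.
    case: (c' =P c0) => [ec'|ne'].
      rewrite ec' in e1 e2; have lt : g c < t.
        by rewrite h1' // -e2; have := lam_decr (leqnSn c.1); rewrite -e1 e0.
      by rewrite lt.
    by have := h3 c c' e1 e2; case: ifP; case: ifP; lia.
  move=> v; rewrite ltnS leq_eqVlt => /orP[/eqP ->|vt].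
    rewrite tau_t -(card1 c0); apply: eq_card => c; rewrite !inE upE.
    case: (altP (c =P c0)) => _; first by rewrite eqxx.
    by apply/eqP; case: ifP; lia.
  rewrite -h4 //; apply: eq_card => c; rewrite !inE upE.
  case: (c =P c0) => [->|_]; first by rewrite g0.
  by case: ifP => // lt; apply/eqP/eqP; have := ltn_ord (g c); lia.
rewrite -(card_in_imset (f := down)); last first.
  by move=> g g'; rewrite !inE => /andP[gS /eqP g0] /andP[gS' /eqP g0'] e;
     rewrite -(up_down g) // e up_down.
apply: eq_card => g; rewrite [RHS]inE; apply/imsetP/idP => [[g']|gS].
  by rewrite inE => /andP[gS /eqP g0] ->; apply: down_ssyt.
exists (up g); last by rewrite down_up.
by rewrite inE up_ssyt // upE eqxx /=.
Qed.

Lemma grid_kostka_rec :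
  grid_kostka t.+1 lam tau = \sum_(i < N | lam i.+1 < lam i) grid_kostka t (decr_row lam i) tau.
Proof.
transitivity (\sum_(c : grid) #|[pred g : {ffun grid -> 'I_t.+2} | grid_ssyt lam tau g && (g c == t :> nat)]|).
  rewrite /grid_kostka -sum1_card.
  under [RHS]eq_bigr => c _ do rewrite -sum1_card big_mkcond.
  rewrite [RHS]exchange_big big_mkcond /=; apply: eq_bigr => g _; rewrite inE.
  case: ifP => gS; last by rewrite big1 // => c _; rewrite inE gS.
  have /grid_ssytP [_ _ _ h4] := gS.
  transitivity #|[pred c : grid | g c == t :> nat]|; first by rewrite h4.
  by rewrite -sum1_card big_mkcond; apply: eq_bigr => c _; rewrite !inE gS.
transitivity (\sum_(i < N) \sum_(j < L) #|[pred g : {ffun grid -> 'I_t.+2} | grid_ssyt lam tau g && (g (i, j) == t :> nat)]|).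
  by rewrite pair_bigA; apply: eq_bigr => -[].
rewrite [RHS]big_mkcond; apply: eq_bigr => i _.
have zero (j : 'I_L) : ~~ ((lam i == j.+1) && (lam i.+1 < lam i)) ->
   #|[pred g : {ffun grid -> 'I_t.+2} | grid_ssyt lam tau g && (g (i, j) == t :> nat)]| = 0.
  move=> nc; apply: eq_card0 => g; rewrite inE; apply/negP => /andP[gS /eqP gc].
  by case/negP: nc; have [/= -> ->] := grid_max_corner gS gc; rewrite eqxx.
case: ifP => corner; last by rewrite big1 // => j _; rewrite zero // corner andbF.
have l1 : (lam i).-1 < L by have := lamL i; lia.
rewrite (bigD1 (Ordinal l1)) //= big1 ?addn0 => [|j ne].
  by apply: (card_grid_corner (c0 := (i, Ordinal l1))) => //=; lia.
apply: zero; rewrite corner andbT; apply: contra ne => /eqP e; apply/eqP/val_inj; rewrite /= e //.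
Qed.

End Grid.

Section KostkaGrid.
Variables (N L : nat) (lam tau : seq nat).
Hypothesis lam_decr : forall i j, i <= j -> nth 0 lam j <= nth 0 lam i.
Hypothesis lamN : size lam <= N.
Hypothesis lamL : forall i, nth 0 lam i <= L.
Notation grid := ('I_N * 'I_L)%type.
Notation C := (cells lam).
Notation t := (size tau).

Lemma mem_cells i j : ((i, j) \in C) = (j < nth 0 lam i).
Proof.
apply/allpairsPdep/idP => [[i' [j' [_ j'l [-> ->]]]]|jl].
  by move: j'l; rewrite mem_iota.
exists i, j; split=> //; rewrite mem_iota //= add0n.
by rewrite ltnNge; apply/negP => h; rewrite nth_default in jl.
Qed.

Lemma uniq_cells : uniq C.
Proof.
apply: allpairs_uniq_dep => [|i _|]; rewrite ?iota_uniq //.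
by move=> [i j] [i' j'] _ _ /= [-> ->].
Qed.

(** Left and upper neighbours of a cell of the shape lie in the shape, so the rectangle imposes the
    conditions between cells and no others: leaving the shape along a row reaches the largest value,
    and along a column it is exempted. *)
Lemma kostka_grid : kostka lam tau = grid_kostka N L t (nth 0 lam) (nth 0 tau).
Proof.
have ex_pos (a : 'I_(size C)) : exists c : grid, (c.1 : nat, c.2 : nat) = nth (0, 0) C a.
  have := mem_nth (0, 0) (ltn_ord a); case: (nth _ _ _) => i j; rewrite mem_cells => jl.
  have iN : i < N.
    by rewrite ltnNge; apply/negP => h; rewrite nth_default ?(leq_trans lamN) in jl.
  by exists (Ordinal iN, Ordinal (leq_trans jl (lamL i))).
have /fin_all_exists [pos posE] := ex_pos.
have pos_inj : injective pos.
  move=> a b e; apply/ord_inj/eqP; rewrite -(nth_uniq (0, 0) (ltn_ord a) (ltn_ord b) uniq_cells).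
  by rewrite -!posE e.
have pos_in a : (pos a).2 < nth 0 lam (pos a).1.
  by rewrite -mem_cells posE mem_nth.
have eq_cell (c c' : grid) : c'.1 = c.1 :> nat -> c'.2 = c.2 :> nat -> c = c'.
  by case: c c' => [i j] [i' j'] /= /ord_inj -> /ord_inj ->.
have pos_onto (c : grid) : c.2 < nth 0 lam c.1 -> exists a, c = pos a.
  rewrite -mem_cells => cC; have ia : index (c.1 : nat, c.2 : nat) C < size C by rewrite index_mem.
  exists (Ordinal ia); have := posE (Ordinal ia); rewrite /= nth_index // => -[e1 e2].
  exact: eq_cell.
pose G (f : {ffun 'I_(size C) -> 'I_t}) : {ffun grid -> 'I_t.+1} :=
  [ffun c => if [pick a | pos a == c] is Some a then widen_ord (leqnSn t) (f a) else ord_max].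
have GE f a : G f (pos a) = f a :> nat.
  rewrite ffunE; case: pickP => [b /eqP/pos_inj -> //|/(_ a)]; by rewrite eqxx.
have GE0 f (c : grid) : nth 0 lam c.1 <= c.2 -> G f c = t :> nat.
  move=> cl; rewrite ffunE; case: pickP => [b /eqP e|//].
  by have := pos_in b; rewrite e ltnNge cl.
have Glt f (c : grid) : (G f c < t) = (c.2 < nth 0 lam c.1).
  case: (ltnP c.2 (nth 0 lam c.1)) => cl; last by rewrite GE0 // ltnn.
  by have [a ->] := pos_onto c cl; rewrite GE ltn_ord.
have G_inj : injective G.
  by move=> f f' e; apply/ffunP => a; apply/ord_inj; rewrite -!GE e.
have adj (b : 'I_(size C)) i j : (nth (0, 0) C b == (i, j)) = ((pos b).1 == i :> nat) && ((pos b).2 == j :> nat).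
  by rewrite -posE xpair_eqE.
have cnt (f : {ffun 'I_(size C) -> 'I_t}) (v : 'I_t) : #|[pred c : grid | G f c == v :> nat]| = #|[pred a | f a == v]|.
  rewrite -(card_imset _ pos_inj); apply: eq_card => c; rewrite inE; apply/idP/imsetP => [/eqP Gc|[a]].
    have [a ca] : exists a, c = pos a by apply: pos_onto; rewrite -(Glt f) Gc.
    by exists a => //; rewrite inE -val_eqE /= -GE -ca Gc.
  by rewrite inE => /eqP fa ->; rewrite GE fa.
have GS (f : {ffun 'I_(size C) -> 'I_t}) : is_ssyt f = grid_ssyt (nth 0 lam) (nth 0 tau) (G f).
  apply/andP/grid_ssytP => [[/forallP h1 /forallP h2]|[h1 h2 h3 h4]].
    have rel a b := forallP (h1 a) b.
    split=> //.
    - move=> c c' e1 e2; case: (ltnP c'.2 (nth 0 lam c'.1)) => c'l; last by rewrite (GE0 f c') // -ltnS.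
      have [a ca] : exists a, c = pos a by apply: pos_onto; rewrite -e1; apply: leq_trans c'l; rewrite e2.
      have [b cb] := pos_onto c' c'l; have := rel a b; rewrite /= !adj -!posE /= -ca -cb e1 e2 !eqxx /=.
      by move=> /andP[]; rewrite -!GE -ca -cb.
    - move=> c c' e1 e2; rewrite Glt => c'l.
      have [a ca] : exists a, c = pos a.
        by apply: pos_onto; rewrite -e2; apply: leq_trans c'l _; apply: lam_decr; rewrite e1.
      have [b cb] := pos_onto c' c'l; have := rel a b; rewrite /= !adj -!posE /= -ca -cb e1 e2 !eqxx /=.
      by move=> /andP[_]; rewrite -!GE -ca -cb.
    - by move=> v vt; rewrite (cnt f (Ordinal vt)); exact: (eqP (h2 (Ordinal vt))).
  split; last by apply/forallP => v; rewrite -cnt h4.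
  apply/forallP => a; apply/forallP => b /=; rewrite !adj -!posE /=; apply/andP; split.
    by apply/implyP => /andP[/eqP e1 /eqP e2]; have := h2 (pos a) (pos b) e1 e2; rewrite !GE.
  apply/implyP => /andP[/eqP e1 /eqP e2]; have := h3 (pos a) (pos b) e1 e2; rewrite !GE.
  by apply.
rewrite /kostka /grid_kostka -(card_imset _ G_inj); apply: eq_card => g; rewrite [RHS]inE.
apply/imsetP/idP => [[f]|gS]; first by rewrite inE GS => fS ->.
have /grid_ssytP [h1 _ _ _] := gS.
have ex_f (a : 'I_(size C)) : exists v : 'I_t, v = g (pos a) :> nat.
  have ltg : g (pos a) < t by rewrite h1 pos_in.
  by exists (Ordinal ltg).
have /fin_all_exists [f fE] := ex_f.
have gE : g = G (finfun f).
  apply/ffunP => c; apply/ord_inj; case: (ltnP c.2 (nth 0 lam c.1)) => cl.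
    by have [a ->] := pos_onto c cl; rewrite GE ffunE fE.
  rewrite GE0 //; apply/eqP; rewrite eqn_leq -ltnS ltn_ord /= leqNgt h1.
  by rewrite -leqNgt.
by exists (finfun f) => //; rewrite inE GS -gE.
Qed.

End KostkaGrid.

(** * Kostka numbers through skew shapes *)

Section KostkaSkew.
Local Open Scope ring_scope.

Lemma incr_perm_eq1 N (w : 'S_N) : (forall i j : 'I_N, (i < j)%N -> (w i < w j)%N) -> w = 1%g.
Proof.
move=> incr; have le (i : 'I_N) : (i <= w i)%N.
  case: i => i; elim: i => // i IH iN.
  by apply: leq_ltn_trans (IH (ltnW iN)) _; apply: incr.
apply/permP => i; rewrite perm1; apply/esym/ord_inj/eqP; rewrite eqn_leq le /= leqNgt.
apply/negP => lt; have : (\sum_(j < N) j < \sum_(j < N) w j)%N.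
  rewrite (bigD1 i) //= [in X in (_ < X)%N](bigD1 i) //= -addSn leq_add //.
  by apply: leq_sum.
by rewrite [X in (_ < X)%N](_ : _ = \sum_(j < N) j)%N ?ltnn // [RHS](reindex_inj (@perm_inj _ w)).
Qed.

(** In a nonzero term [w] matches two strictly decreasing sequences, so it is increasing and hence
    the identity. *)
Lemma det_eq_decr N (l m : 'I_N -> nat) :
  (forall i j : 'I_N, (i < j)%N -> (l j < l i)%N) -> (forall i j : 'I_N, (i < j)%N -> (m j < m i)%N) ->
  \det (\matrix_(i, j) (l i == m j)%:R) = [forall i, l i == m i]%:R :> rat.
Proof.
move=> ldecr mdecr; rewrite /determinant (bigD1 1%g) //= odd_perm1 expr0 mul1r.
rewrite [X in _ + X]big1 ?addr0 => [|w w1]; last first.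
  case: (pickP (fun i => l i != m (w i))) => [i ni|all].
    by rewrite (bigD1 i) //= mxE (negPf ni) mul0r mulr0.
  case/eqP: w1; apply: incr_perm_eq1 => i j ij.
  have lm a : l a = m (w a) by move: (all a) => /negbFE/eqP.
  have := ldecr i j ij; rewrite !lm => mm; case: (ltngtP (w i) (w j)) => // [/mdecr|/ord_inj e].
    by move=> mm'; have := ltn_trans mm mm'; rewrite ltnn.
  by rewrite e ltnn in mm.
case: forallP => h; first by rewrite big1 // => i _; rewrite mxE perm1 (eqP (h i)) eqxx.
have /existsP [i hi] : [exists i, l i != m i] by rewrite -negb_forall; apply/forallP.
by rewrite (bigD1 i) //= mxE perm1 (negPf hi) mul0r.
Qed.

Lemma shifted_decr N (nu : nat -> nat) : (forall i j, (i <= j)%N -> (nu j <= nu i)%N) ->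
  forall i j : 'I_N, (i < j)%N -> (shifted nu j < shifted nu i)%N.
Proof.
move=> nu_decr i j ij; have := nu_decr _ _ (ltnW ij); rewrite /shifted /stair.
by have := ltn_ord i; have := ltn_ord j; lia.
Qed.

Lemma sum_shifted N (nu : nat -> nat) :
  (\sum_(i < N) shifted nu i = \sum_(i < N) nu i + \sum_(i < N) stair i)%N.
Proof. by rewrite -big_split. Qed.

Lemma eq_skew_det N (m m' u u' : 'I_N -> nat) : m =1 m' -> u =1 u' -> skew_det m u = skew_det m' u'.
Proof. by move=> em eu; congr (\det _); apply/matrixP => i j; rewrite !mxE em eu. Qed.

Lemma skew_det_repeat N (m u : 'I_N -> nat) i j : i != j -> u i = u j -> skew_det m u = 0.
Proof.
move=> ij e; apply: (determinant_alternate ij) => a; by rewrite !mxE e.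
Qed.

Lemma eq_grid_kostka N L t (lam lam' tau tau' : nat -> nat) : lam =1 lam' ->
  (forall v, (v < t)%N -> tau v = tau' v) -> grid_kostka N L t lam tau = grid_kostka N L t lam' tau'.
Proof.
move=> el et; apply: eq_card => g; rewrite !inE; congr [&& _, _, _ & _].
  by apply: eq_forallb => c; rewrite el.
by apply: eq_forallb => v; rewrite et.
Qed.

Variable mu : seq nat.
Let k := sumn mu.

(** A partition of [k] has at most [k] parts, all at most [k]; padded with zeros it becomes an
    element of a finite type over which one can sum. *)
Definition shape_seq (nu : {ffun 'I_k -> 'I_k.+1}) : seq nat := [seq (nu i : nat) | i <- enum 'I_k].

Definition is_shape (nu : {ffun 'I_k -> 'I_k.+1}) : bool :=
  [forall i : 'I_k, forall j : 'I_k, (i <= j)%N ==> (nu j <= nu i)%N] && (\sum_i nu i == k)%N.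

Lemma size_shape_seq nu : size (shape_seq nu) = k.
Proof. by rewrite size_map size_enum_ord. Qed.

Lemma nth_shape_seq nu (i : 'I_k) : nth 0%N (shape_seq nu) i = nu i.
Proof. by rewrite (nth_map i) ?size_enum_ord // nth_ord_enum. Qed.

Lemma shape_seq_decr nu : is_shape nu ->
  forall i j, (i <= j)%N -> (nth 0%N (shape_seq nu) j <= nth 0%N (shape_seq nu) i)%N.
Proof.
move=> /andP[/forallP h _] i j ij; case: (ltnP j k) => jk; last by rewrite [leqLHS]nth_default ?size_shape_seq.
have := h (Ordinal (leq_ltn_trans ij jk)) => /forallP /(_ (Ordinal jk)) /=; rewrite ij /=.
by rewrite -!nth_shape_seq.
Qed.

Lemma shape_seq_le nu i : (nth 0%N (shape_seq nu) i <= k)%N.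
Proof.
case: (ltnP i k) => ik; last by rewrite nth_default ?size_shape_seq.
by rewrite (nth_shape_seq nu (Ordinal ik)) -ltnS ltn_ord.
Qed.

Lemma sum_shape_seq nu N : is_shape nu -> (k <= N)%N -> (\sum_(i < N) nth 0 (shape_seq nu) i = k)%N.
Proof.
move=> /andP[_ /eqP nuk] kN; rewrite -[RHS]nuk [in RHS](eq_bigr (fun i : 'I_k => nth 0%N (shape_seq nu) i)); last first.
  by move=> i _; rewrite nth_shape_seq.
rewrite (big_ord_widen N (nth 0%N (shape_seq nu)) kN) [RHS]big_mkcond; apply: eq_bigr => i _.
by case: ltnP => // h; rewrite nth_default ?size_shape_seq.
Qed.

Lemma shape_exists N (lam : nat -> nat) : (forall i j, (i <= j)%N -> (lam j <= lam i)%N) ->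
  (forall i, (N <= i)%N -> lam i = 0%N) -> (k <= N)%N -> (\sum_(i < N) lam i = k)%N ->
  exists2 nu, is_shape nu & nth 0%N (shape_seq nu) =1 lam.
Proof.
move=> lam_decr lam0 kN sl.
have lam_k i : (k <= i)%N -> lam i = 0%N.
  move=> ki; apply/eqP; rewrite -leqn0 leqNgt; apply/negP => li.
  have iN : (i < N)%N by rewrite ltnNge; apply/negP => /lam0 l0; rewrite l0 in li.
  have : (\sum_(a < N | (a < i.+1)%N) 1 <= \sum_(a < N) lam a)%N.
    rewrite big_mkcond; apply: leq_sum => a _; case: ifP => // ai.
    by apply: leq_trans li _; apply: lam_decr.
  rewrite -(big_ord_widen _ (fun _ => 1%N) iN) sum1_card card_ord sl; lia.
have lam_le i : (lam i < k.+1)%N.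
  rewrite ltnS; case: (ltnP i N) => iN; last by rewrite lam0.
  by rewrite -[leqRHS]sl (bigD1 (Ordinal iN)) //= leq_addr.
pose nu : {ffun 'I_k -> 'I_k.+1} := [ffun i : 'I_k => Ordinal (lam_le i)].
have nuE : nth 0%N (shape_seq nu) =1 lam.
  move=> i; case: (ltnP i k) => ik; last by rewrite nth_default ?size_shape_seq ?lam_k.
  by rewrite (nth_shape_seq nu (Ordinal ik)) ffunE.
exists nu => //; apply/andP; split.
  by apply/forallP => i; apply/forallP => j; apply/implyP => ij; rewrite !ffunE /= lam_decr.
apply/eqP; rewrite -[RHS]sl (eq_bigr (fun i : 'I_k => lam i)) => [|i _]; last by rewrite ffunE.
rewrite (big_ord_widen N lam kN) big_mkcond; apply: eq_bigr => i _.
by case: ltnP => // /lam_k.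
Qed.

Definition type_ones v : nat := if (v < size mu)%N then nth 0%N mu v else 1%N.

(** Removing the largest entry on the left and lowering one coordinate on the right give the same
    recursion in [j]. For j = 0 the determinant is 1 if the shape is [lam] and 0 otherwise. *)
Lemma grid_kostka_skew N L : (k <= N)%N -> (k <= L)%N -> forall j (lam : nat -> nat),
  (forall i j, (i <= j)%N -> (lam j <= lam i)%N) -> (forall i, (N <= i)%N -> lam i = 0%N) ->
  (forall i, (lam i <= L)%N) -> (\sum_(i < N) lam i = k + j)%N ->
  (grid_kostka N L (size mu + j) lam type_ones)%:R =
  \sum_(nu | is_shape nu) (kostka (shape_seq nu) mu)%:R *
     (j`!%:R * skew_det (shifted (nth 0%N (shape_seq nu)) (N := N)) (shifted lam (N := N))).
Proof.
move=> kN kL; elim=> [|j IH] lam lam_decr lam0 lamL sl.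
  rewrite addn0 in sl; rewrite addn0.
  have [nu0 nu0S nu0E] := shape_exists lam_decr lam0 kN sl.
  rewrite (bigD1 nu0) //= big1 ?addr0 => [|nu /andP[nuS ne]].
    rewrite mul1r skew_det_eq_size; last by rewrite !sum_shifted sl sum_shape_seq.
    rewrite det_eq_decr; [|exact: shifted_decr|exact/shifted_decr/shape_seq_decr].
    have -> : [forall i, shifted lam i == shifted (nth 0%N (shape_seq nu0)) (N := N) i].
      by apply/forallP => i; rewrite /shifted nu0E.
    rewrite mulr1; congr _%:R; rewrite (kostka_grid (N := N) (L := L)).
    - apply: eq_grid_kostka => [i|v vt]; first by rewrite nu0E.
      by rewrite /type_ones vt.
    - exact: shape_seq_decr.
    - by rewrite size_shape_seq.
    - by move=> i; rewrite (leq_trans (shape_seq_le _ _)).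
  rewrite skew_det_eq_size; last by rewrite !sum_shifted sl sum_shape_seq.
  rewrite det_eq_decr; [|exact: shifted_decr|exact/shifted_decr/shape_seq_decr].
  case: forallP => [h|]; last by rewrite !mulr0.
  case/eqP: ne; apply/ffunP => i; apply/ord_inj; rewrite -!nth_shape_seq nu0E.
  have := h (widen_ord kN i); rewrite /shifted eqn_add2r => /eqP /= e.
  by rewrite e.
rewrite addnS grid_kostka_rec //; last by rewrite /type_ones ltnNge leq_addr.
rewrite natr_sum (eq_bigr (fun i : 'I_N => \sum_(nu | is_shape nu) (kostka (shape_seq nu) mu)%:R *
   (j`!%:R * skew_det (shifted (nth 0%N (shape_seq nu)) (N := N)) (decr (shifted lam (N := N)) i)))); last first.
  move=> i corner; rewrite IH.
  - apply: eq_bigr => nu _; congr (_ * (_ * _)); apply: eq_skew_det => // a.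
    rewrite /shifted /decr_row /decr -val_eqE /=; case: eqP => [->|_]; last by rewrite !subn0.
    have l0 : (0 < lam i)%N by apply: leq_ltn_trans corner.
    exact: addnBAC.
  - move=> a b ab; rewrite /decr_row; have := lam_decr _ _ ab.
    case: (a =P i :> nat) => [ai|_]; case: (b =P i :> nat) => [bi|nbi]; rewrite ?subn0 //.
    + by move=> _; rewrite ai bi.
    + have ib : (i.+1 <= b)%N by rewrite ltn_neqAle -{2}ai ab andbT eq_sym; apply/eqP.
      have lt := leq_ltn_trans (lam_decr _ _ ib) corner.
      by move=> _; rewrite ai subn1 -ltnS prednK // (leq_ltn_trans _ lt).
    + by move=> le; rewrite (leq_trans (leq_subr _ _)).
  - by move=> a /lam0; rewrite /decr_row => ->.
  - by move=> a; rewrite /decr_row (leq_trans (leq_subr _ _)).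
  apply: succn_inj; rewrite -addnS -sl -(sum_decr (u := fun a : 'I_N => lam a) (i := i)) //=; last by lia.
rewrite exchange_big /=; apply: eq_bigr => nu nuS; rewrite -big_distrr -big_distrr /=; congr (_ * _).
rewrite factS natrM mulrAC skew_det_rec; last by rewrite !sum_shifted sl sum_shape_seq //; lia.
rewrite mulrC; congr (_ * _); rewrite [LHS]big_mkcond [RHS]big_mkcond; apply: eq_bigr => i _.
(* The determinant recursion also visits rows that are not corners. There the lowered coordinate
   equals that of the next row and the determinant vanishes; a last row that is not a corner has
   coordinate 0 and is not visited. *)
case: ltnP => [corner|ncorner].
  by rewrite ifT // /shifted; lia.
case: ltnP => // li; case: (ltnP i.+1 N) => iN.
  rewrite (@skew_det_repeat _ _ _ i (Ordinal iN)) //.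
    by rewrite -val_eqE /=; lia.
  rewrite /decr eqxx -val_eqE /= /shifted /stair /=.
  have -> : (i.+1 == i) = false by lia.
  have := lam_decr _ _ (leqnSn i); lia.
have l0 : lam i = 0%N by move: ncorner; rewrite (lam0 i.+1) //; lia.
by move: li; rewrite /shifted l0 /stair; lia.
Qed.

End KostkaSkew.

(** * Shifted Schur functions and normalized Kostka numbers *)

Section Final.
Local Open Scope ring_scope.

Lemma nonneg_ff_sum d (I : finType) (P : pred I) (c : I -> rat)
    (F : I -> ('I_d -> nat) -> ('I_d -> nat) -> rat) :
  (forall i, P i -> 0 <= c i) -> (forall i, P i -> nonneg_ff_polynomial (F i)) ->
  nonneg_ff_polynomial (fun p r => \sum_(i | P i) c i * F i p r).
Proof.
move=> c0 FP.
have ex i : exists s : seq (('I_d -> nat) * ('I_d -> nat) * rat), P i ->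
    all (fun t => 0 <= t.2) s /\
    forall p r, F i p r = \sum_(t <- s) t.2 * ff_monomial t.1.1 t.1.2 p r.
  case: (boolP (P i)) => [/FP [s sP]|_]; last by exists [::].
  by exists s.
have /fin_all_exists [s sP] := ex.
exists (flatten [seq [seq (t.1, c i * t.2) | t <- s i] | i <- enum P]); split.
  have : {subset enum P <= P} by move=> i; rewrite mem_enum.
  elim: (enum P) => //= i l IH sub; rewrite all_cat IH ?andbT => [|j jl]; last first.
    by apply: sub; rewrite inE jl orbT.
  have Pi : P i by apply: sub; rewrite inE eqxx.
  rewrite all_map; have [s0 _] := sP i Pi; apply: sub_all s0 => t t0 /=.
  by rewrite mulr_ge0 // c0.
move=> p r; rewrite big_flatten /= big_map big_enum /=; apply: eq_bigr => i Pi.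
have [_ ->] := sP i Pi; rewrite big_map big_distrr /=; apply: eq_bigr => t _.
by rewrite mulrA.
Qed.

Lemma eq_nonneg_ff d (F G : ('I_d -> nat) -> ('I_d -> nat) -> rat) :
  (forall p r, F p r = G p r) -> nonneg_ff_polynomial G -> nonneg_ff_polynomial F.
Proof. by move=> e [s [s0 sE]]; exists s; split=> // p r; rewrite e. Qed.

Lemma partition_decr mu : is_partition mu ->
  forall i j, (i <= j)%N -> (nth 0%N mu j <= nth 0%N mu i)%N.
Proof.
move=> /andP[ms _] i j ij; case: (ltnP j (size mu)) => jm; last by rewrite [leqLHS]nth_default.
have geq_trans : transitive geq by move=> y x z /= h1 h2; exact: leq_trans h2 h1.
by apply: (sorted_leq_nth geq_trans (fun x => leqnn x)) => //; rewrite inE ?(leq_ltn_trans ij).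
Qed.

(** Since (x)_m = x!/(x - m)!, with both sides read as 0 for m > x, the factorial of the i-th
    shifted coordinate factors out of row i in both determinants and cancels. *)
Lemma shifted_schur_skew mu lam : let N := (size lam + size mu)%N in
  shifted_schur mu lam =
  skew_det (@shifted (nth 0%N mu) N) (@shifted (nth 0%N lam) N) /
  skew_det (@stair N) (@shifted (nth 0%N lam) N).
Proof.
move=> N.
have det_falling (m u : 'I_N -> nat) :
    \det (\matrix_(i, j) ((u i) ^_ (m j))%:R) = (\prod_i (u i)`!%:R) * skew_det m u :> rat.
  rewrite /skew_det [X in _ * X]/determinant big_distrr /=; apply: eq_bigr => w _.
  rewrite mulrCA -big_split /=; congr (_ * _); apply: eq_bigr => i _; rewrite !mxE.
  case: leqP => mu'; last by rewrite ffact_small // mulr0.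
  by rewrite -(ffact_fact mu') natrM mulfK // pnatr_eq0 -lt0n fact_gt0.
rewrite /shifted_schur -/N.
rewrite (_ : \matrix_(i, j) _ = \matrix_(i, j) ((shifted (nth 0%N lam) i) ^_ (shifted (nth 0%N mu) j))%:R); last first.
  by apply/matrixP => i j; rewrite !mxE /shifted /stair -!subnDA !add1n.
rewrite (_ : \det (\matrix_(i, j) ((nth 0 lam i + (N - 1 - i)) ^_ (N - 1 - j))%:R) =
  \det (\matrix_(i, j) ((shifted (nth 0%N lam) i) ^_ (@stair N j))%:R)); last first.
  by congr (\det _); apply/matrixP => i j; rewrite !mxE /shifted /stair -!subnDA !add1n.
rewrite !det_falling -mulf_div divff ?mul1r //.
by apply/prodf_neq0 => i _; rewrite pnatr_eq0 -lt0n fact_gt0.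
Qed.

Lemma sumn_nth (s : seq nat) N : (size s <= N)%N -> sumn s = (\sum_(i < N) nth 0 s i)%N.
Proof.
move=> sN; rewrite sumnE (big_nth 0%N) big_mkord (big_ord_widen N (nth 0%N s) sN) big_mkcond.
by apply: eq_bigr => i _; case: ltnP => // h; rewrite nth_default.
Qed.

(** The denominator is the numerator's formula for the empty partition, whose only shape is empty
    and whose determinant is that of the staircase. The remaining factor (n)_k (n - k)! / n! is
    1. *)
Lemma Ko_skew mu lam : (forall i j, (i <= j)%N -> (nth 0%N lam j <= nth 0%N lam i)%N) ->
  let N := (size lam + sumn mu)%N in
  Ko mu lam = \sum_(nu | @is_shape mu nu) (kostka (shape_seq nu) mu)%:R *
    (skew_det (@shifted (nth 0%N (shape_seq nu)) N) (@shifted (nth 0%N lam) N) /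
     skew_det (@stair N) (@shifted (nth 0%N lam) N)).
Proof.
move=> lam_decr N; pose n := sumn lam; pose k := sumn mu.
have sl : (\sum_(i < N) nth 0 lam i = n)%N by rewrite -sumn_nth // leq_addr.
have lam0 i : (N <= i)%N -> nth 0%N lam i = 0%N.
  by move=> Ni; rewrite nth_default // (leq_trans (leq_addr _ _) Ni).
have lamn i : (nth 0%N lam i <= n)%N.
  case: (ltnP i N) => iN; last by rewrite lam0.
  by rewrite -sl (bigD1 (Ordinal iN)) //= leq_addr.
have kN : (k <= N)%N by rewrite leq_addl.
rewrite /Ko -/n -/k; case: leqP => kn; last first.
  rewrite big1 // => nu nuS; rewrite skew_det0 ?mul0r ?mulr0 //.
  by rewrite !sum_shifted sl (sum_shape_seq nuS kN) ltn_add2r.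
have kostka_ones (tau : seq nat) j : (sumn tau <= N)%N -> (sumn tau <= n)%N -> (n = sumn tau + j)%N ->
  (kostka lam (tau ++ nseq j 1%N))%:R =
  \sum_(nu | @is_shape tau nu) (kostka (shape_seq nu) tau)%:R *
     (j`!%:R * skew_det (@shifted (nth 0%N (shape_seq nu)) N) (@shifted (nth 0%N lam) N)) :> rat.
  move=> tN tn nE; rewrite -(@grid_kostka_skew tau N n) // ?sl //; congr _%:R.
  rewrite (kostka_grid (N := N) (L := n)) ?leq_addr // size_cat size_nseq.
  apply: eq_grid_kostka => // v vt; rewrite nth_cat /type_ones; case: ltnP => // h.
  by rewrite nth_nseq ifT // ltn_subLR.
have -> : (kostka lam (nseq n 1%N))%:R = n`!%:R * skew_det (@stair N) (@shifted (nth 0%N lam) N) :> rat.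
  rewrite -[nseq n 1%N]cat0s kostka_ones //.
  pose nu0 : {ffun 'I_(sumn [::]) -> 'I_(sumn [::]).+1} := [ffun=> ord0].
  have nuE (nu : {ffun 'I_(sumn [::]) -> 'I_(sumn [::]).+1}) : nu = nu0 by apply/ffunP => -[].
  rewrite (big_pred1 nu0) => [|nu]; last first.
    rewrite (nuE nu) /= eqxx; apply/andP; split; first by apply/forallP => -[].
    by rewrite big_ord0.
  have s0 : shape_seq nu0 = [::] by apply/size0nil; rewrite size_shape_seq.
  rewrite s0; have -> : kostka [::] [::] = 1%N.
    rewrite /kostka -[RHS](card1 (finfun (fun x : 'I_0 => x))); apply: eq_card => f; rewrite !inE.
    have -> : f = finfun (fun x : 'I_0 => x) by apply/ffunP => -[].
    by rewrite eqxx; apply/andP; split; apply/forallP => -[].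
  rewrite mul1r; congr (_ * _); apply: eq_skew_det => // i.
  by rewrite /shifted nth_nil.
rewrite kostka_ones ?subnKC //.
have := @skew_det_neq0 _ (fun i : 'I_N => nth 0%N lam i) (fun i j => lam_decr i j).
rewrite -/(@shifted (nth 0%N lam) N); set D := skew_det (@stair N) _ => D0.
rewrite mulr_sumr mulr_suml; apply: eq_bigr => nu _.
have fk0 : (n ^_ k)%:R != 0 :> rat by rewrite pnatr_eq0 -lt0n ffact_gt0.
have f0 : ((n - k)`!)%:R != 0 :> rat by rewrite pnatr_eq0 -lt0n fact_gt0.
by rewrite -(ffact_fact kn) natrM; field; rewrite D0 fk0 f0.
Qed.

End Final.

Theorem theorem1p2 (d : nat) (hd : 0 < d) (mu : seq nat) (hmu : is_partition mu) :
  @nonneg_ff_polynomial d (fun p r => shifted_schur mu (@multirect d p r)) /\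
  @nonneg_ff_polynomial d (fun p r => Ko mu (@multirect d p r)).
Proof.
split.
  apply: (eq_nonneg_ff (fun p r => shifted_schur_skew mu (multirect p r))).
  apply: (@nonneg_skew_ratio d (nth 0 mu) (size mu) (size mu)) => //.
    exact: partition_decr.
  by move=> i; exact: nth_default.
apply: (eq_nonneg_ff (fun p r => Ko_skew mu (@multirect_decr d p r))).
apply: nonneg_ff_sum => nu nuS; first exact: ler0n.
apply: (@nonneg_skew_ratio d (nth 0 (shape_seq nu)) (sumn mu) (sumn mu)) => //.
  exact: shape_seq_decr.
by move=> i ki; rewrite nth_default ?size_shape_seq.
Qed.
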